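(* Let $(\Omega,\Sigma,\mu)$ be a positive $\sigma$-finite measure space, let $X$ be a Banach space, and let $H$ be a bounded subset of $L^1(\Omega,\mu,X)$. Then the following are equivalent: (1) $H$ is relatively weakly compact in $L^1(\Omega,\mu,X)$. (2) $H$ is $\mathcal{A}$-equi-integrable, and for every sequence $\{f_n\}_{n\in\mathbb{N}}\subset H$ there exists a sequence $\{g_n\}_{n\in\mathbb{N}}$ with $g_n\in \mathrm{co}\{f_k: k\ge n\}$ for all $n$ such that $\{g_n(\omega)\}_{n\in\mathbb{N}}$ is norm convergent in $X$ for a.e. $\omega\in\Omega$. (3) $H$ is $\mathcal{A}$-equi-integrable, and for every sequence $\{f_n\}_{n\in\mathbb{N}}\subset H$ there exists a sequence $\{g_n\}_{n\in\mathbb{N}}$ with $g_n\in \mathrm{co}\{f_k: k\ge n\}$ for all $n$ such that $\{g_n(\omega)\}_{n\in\mathbb{N}}$ is weakly convergent in $X$ for a.e. $\omega\in\Omega$.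
   Context: $L^1(\Omega,\mu,X)$ is the Banach space of Bochner integrable functions $f:\Omega\to X$, and $\mathrm{co}$ denotes the convex hull. A set $H\subset L^1(\Omega,\mu,X)$ is uniformly integrable if $\lim_{\mu(E)\to 0}\int_E\|f\|\,d\mu=0$ uniformly for $f\in H$. The set $H$ is called $\mathcal{A}$-equi-integrable if there exists a $\sigma$-finite coverage $\mathcal{A}=\{A_n\}_{n\in\mathbb{N}}$ of $\Omega$, i.e. measurable sets of finite measure with $A_n\subset A_{n+1}$ and $\Omega=\bigcup_{k=1}^\infty A_k$ (with the convention $A_0=\emptyset$), such that (a) $H$ is uniformly integrable, and (b) there exists a sequence $\{a_n\}_{n\in\mathbb{N}}\in \ell^1(\mathbb{N})$ of nonnegative numbers such that $\int_{A_n\setminus A_{n-1}}\|f\|\,d\mu\le a_n$ for all $f\in H$ and all $n\in\mathbb{N}$. *)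

(* Defs.v *)
From HB Require Import structures.
From mathcomp Require Import all_boot all_order all_algebra generic_quotient ring_quotient.
From mathcomp Require Import all_classical all_reals all_analysis measurable_realfun.

Set Implicit Arguments.
Unset Strict Implicit.
Unset Printing Implicit Defensive.

Import Order.TTheory GRing.Theory Num.Theory.
Import numFieldNormedType.Exports.

Local Open Scope classical_set_scope.
Local Open Scope ring_scope.

(* Equivalently, a finite sum of constant vectors times indicators of
   measurable sets. *)
Definition simple_function d (T : measurableType d) (X : Type) (s : T -> X) :=
  finite_set (range s) /\ forall x : X, measurable (s @^-1` [set x]).

Section bochner_integrable.
Context d (T : measurableType d) (R : realType) (X : normedModType R).
Variable mu : {measure set T -> \bar R}.

Definition strongly_measurable (f : T -> X) :=
  exists s : nat -> T -> X, (forall n, simple_function (s n)) /\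
    {ae mu, forall t, s ^~ t @ \oo --> f t}.

Definition bochner_integrable (f : T -> X) :=
  strongly_measurable f /\ (\int[mu]_t `|f t|%:E < +oo)%E.

End bochner_integrable.

Section simple_function_theory.
Context d (T : measurableType d).

Lemma simple_preimage (X : Type) (s : T -> X) (B : set X) :
  simple_function s -> measurable (s @^-1` B).
Proof.
move=> [fs ms].
rewrite (_ : _ @^-1` _ = \bigcup_(x in range s `&` B) s @^-1` [set x]).
  by apply: fin_bigcup_measurable => //; exact: finite_setIl.
by apply/seteqP; split => [t Bt|t [x [_ Bx] /= ->//]]; exists (s t).
Qed.

Lemma simple_cst (X : Type) (x : X) : simple_function (fun _ : T => x).
Proof.
split=> [|y]; first by apply: (sub_finite_set _ (finite_set1 x)) => _ [t _ <-].
by rewrite preimage_cst; case: ifP.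
Qed.

Lemma simple_op2 (X Y Z : Type) (op : X -> Y -> Z) (s : T -> X) (u : T -> Y) :
  simple_function s -> simple_function u ->
  simple_function (fun t => op (s t) (u t)).
Proof.
move=> ss su; split=> [|z].
  apply: (sub_finite_set _ (finite_image2 op ss.1 su.1)) => _ [t _ <-] /=.
  by exists (s t); [exists t|exists (u t) => //; exists t].
rewrite (_ : _ @^-1` _ = \bigcup_(x in range s)
    ((s @^-1` [set x]) `&` (u @^-1` [set y | op x y = z]))).
  apply: fin_bigcup_measurable => [|x _]; first exact: ss.1.
  by apply: measurableI; exact: simple_preimage.
apply/seteqP; split => [t /= tz|t [x _ [/= -> //]]].
by exists (s t) => //; exists t.
Qed.

End simple_function_theory.

Import HBNNSimple.

Section bochner_theory.
Context d (T : measurableType d) (R : realType) (X : normedModType R).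
Variable mu : {measure set T -> \bar R}.

(* No measurability is required of F and G: the integral of a nonnegative
   function is a supremum of integrals of simple functions below it. *)
Lemma ge0_integral_ae_ext (F G : T -> \bar R) :
  (forall t, 0 <= F t)%E -> (forall t, 0 <= G t)%E ->
  {ae mu, forall t, F t = G t} ->
  (\int[mu]_t F t = \int[mu]_t G t)%E.
Proof.
move=> F0 G0 [N [mN N0 FG]].
suff le (F' G' : T -> \bar R) : (forall t, 0 <= F' t)%E ->
    (forall t, 0 <= G' t)%E -> (forall t, ~ N t -> F' t = G' t) ->
    (\int[mu]_t F' t <= \int[mu]_t G' t)%E.
  have FGN t : ~ N t -> F t = G t.
    by move=> Nt; apply: contrapT => h; apply: Nt; apply: FG.
  by apply/eqP; rewrite eq_le !le // => t /FGN.
move=> F'0 G'0 FG'; rewrite !ge0_integralTE//.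
apply: ge_ereal_sup => _ [h hF <-].
have mNC : measurable (~` N) by exact: measurableC.
apply: ereal_sup_ubound; exists (proj_nnsfun h mNC).
  move=> t; rewrite -mrestrict /patch; case: ifPn => tN //.
  by rewrite -FG'//; move: tN; rewrite inE.
have integral_sfun (k : {nnsfun T >-> R}) :
    sintegral mu k = (\int[mu]_t (k t)%:E)%E.
  by rewrite integralT_nnsfun.
rewrite !integral_sfun; apply: ge0_ae_eq_integral => //.
- exact/measurable_EFinP.
- exact/measurable_EFinP.
- by move=> t _; rewrite lee_fin.
- by move=> t _; rewrite lee_fin.
- exists N; split=> // t h'; apply: contrapT => Nt; apply: h' => _ /=.
  by rewrite -[LHS]/((proj_nnsfun h mNC t)%:E) -mrestrict /patch mem_set.
Qed.

Lemma strongly_measurable_norm (f : T -> X) : strongly_measurable mu f ->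
  exists F : T -> R, [/\ measurable_fun setT F, forall t, 0 <= F t &
    {ae mu, forall t, `|f t| = F t}].
Proof.
move=> [s [ss [N [mN N0 sN]]]].
have mNC : measurable (~` N) by exact: measurableC.
exists (fun t => `|f t| * \1_(~` N) t); split.
- apply: (@measurable_fun_cvg _ _ _ _
    (fun n t => `|s n t| * \1_(~` N) t)) => [n|t _].
    apply: measurable_funM; last exact: measurable_indic.
    move=> _ B _; rewrite setTI.
    exact: (@simple_preimage _ _ _ _ [set x | B `|x|] (ss n)).
  rewrite indicE; case: (boolP (t \in ~` N)) => tN.
    apply: cvgM; last exact: cvg_cst.
    apply: cvg_norm.
    by apply: contrapT => h; move: tN; rewrite inE; apply; apply: sN.
  by rewrite mulr0; under eq_fun do rewrite mulr0; exact: cvg_cst.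
- by move=> t; rewrite mulr_ge0.
- exists N; split=> // t /= h; apply: contrapT => Nt; apply: h.
  by rewrite indicE mem_set//= mulr1.
Qed.

Lemma bochner_integrable0 : bochner_integrable mu (0 : T -> X).
Proof.
split; last first.
  by under eq_integral do rewrite normr0; rewrite integral0 ltry.
exists (fun _ _ => 0); split=> [n|]; first exact: simple_cst.
by apply: aeW => t; exact: cvg_cst.
Qed.

Lemma strongly_measurableD (f g : T -> X) :
  strongly_measurable mu f -> strongly_measurable mu g ->
  strongly_measurable mu (f + g).
Proof.
move=> [s [ss sf]] [u [su ug]]; exists (fun n t => s n t + u n t); split.
  by move=> n; exact: (simple_op2 +%R).
by apply: filterS2 sf ug => t; exact: cvgD.
Qed.

Lemma strongly_measurableZ (a : R) (f : T -> X) :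
  strongly_measurable mu f -> strongly_measurable mu (a *: f).
Proof.
move=> [s [ss sf]]; exists (fun n t => a *: s n t); split=> [n|].
  exact: (simple_op2 (fun x (_ : X) => a *: x) (ss n) (simple_cst T 0)).
by apply: filterS sf => t; exact: cvgZr.
Qed.

Lemma integral_normD (f g : T -> X) :
  strongly_measurable mu f -> strongly_measurable mu g ->
  (\int[mu]_t `|(f + g) t|%:E <=
   \int[mu]_t `|f t|%:E + \int[mu]_t `|g t|%:E)%E.
Proof.
move=> mf mg.
have [F [mF F0 fF]] := strongly_measurable_norm mf.
have [G [mG G0 gG]] := strongly_measurable_norm mg.
have [H [mH H0 fgH]] := strongly_measurable_norm (strongly_measurableD mf mg).
have E (k : T -> X) (K : T -> R) : (forall t, 0 <= K t) ->
    {ae mu, forall t, `|k t| = K t} ->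
    (\int[mu]_t `|k t|%:E = \int[mu]_t (K t)%:E)%E.
  move=> K0 kK; apply: ge0_integral_ae_ext => [t|t|]; rewrite ?lee_fin//.
  by apply: filterS kK => t ->.
rewrite (E _ _ H0 fgH) (E _ _ F0 fF) (E _ _ G0 gG) -ge0_integralD//; last first.
- exact/measurable_EFinP.
- by move=> t _; rewrite lee_fin.
- exact/measurable_EFinP.
- by move=> t _; rewrite lee_fin.
apply: ae_ge0_le_integral => //.
- by move=> t _; rewrite lee_fin.
- exact/measurable_EFinP.
- by move=> t _; rewrite adde_ge0 ?lee_fin.
- by apply: emeasurable_funD; exact/measurable_EFinP.
apply: filterS3 fF gG fgH => t <- <- <- _.
by rewrite -EFinD lee_fin; exact: ler_normD.
Qed.

Lemma integral_normZ (a : R) (f : T -> X) : strongly_measurable mu f ->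
  (\int[mu]_t `|(a *: f) t|%:E = `|a|%:E * \int[mu]_t `|f t|%:E)%E.
Proof.
move=> /strongly_measurable_norm[F [mF F0 fF]].
have -> : (\int[mu]_t `|f t|%:E = \int[mu]_t (F t)%:E)%E.
  apply: ge0_integral_ae_ext => [t|t|]; rewrite ?lee_fin//.
  by apply: filterS fF => t ->.
rewrite -ge0_integralZl//; last by move=> t _; rewrite lee_fin.
  apply: ge0_integral_ae_ext => [t|t|]; rewrite -?EFinM ?lee_fin ?mulr_ge0//.
  by apply: filterS fF => t <-; rewrite -EFinM -normrZ.
exact/measurable_EFinP.
Qed.

Lemma integral_norm_eq0 (f : T -> X) : strongly_measurable mu f ->
  (\int[mu]_t `|f t|%:E = 0)%E -> {ae mu, forall t, f t = 0}.
Proof.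
move=> /strongly_measurable_norm[F [mF F0 fF]] f0.
have mF' : measurable_fun setT (EFin \o F) by exact/measurable_EFinP.
have /(ae_eq_integral_abs mu measurableT mF') F_0 :
    (\int[mu]_t `|(EFin \o F) t| = 0)%E.
  rewrite -f0; apply: ge0_integral_ae_ext => [t|t|]; rewrite ?lee_fin//.
  by apply: filterS fF => t ftF; rewrite /= ger0_norm// ftF.
apply: filterS2 fF F_0 => t ftF /(_ I) [Ft0].
by apply/eqP; rewrite -normr_eq0 ftF Ft0.
Qed.

End bochner_theory.

Section bochner_fun.
Context d (T : measurableType d) (R : realType) (X : normedModType R).
Variable mu : {measure set T -> \bar R}.

Definition bochner : {pred T -> X} := mem [set f | bochner_integrable mu f].

Lemma bochner_submod_closed : submod_closed bochner.
Proof.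
split=> [|a f g]; first by rewrite inE; exact: bochner_integrable0.
rewrite !inE => -[mf f_fin] [mg g_fin].
have maf := strongly_measurableZ a mf.
split; first exact: strongly_measurableD.
rewrite (le_lt_trans (integral_normD maf mg))// integral_normZ//.
by rewrite lte_add_pinfty// lte_mul_pinfty.
Qed.

HB.instance Definition _ :=
  GRing.isSubmodClosed.Build R (T -> X) bochner bochner_submod_closed.

Record bochner_fun := BochnerFun {
  bochner_val :> T -> X ;
  bochner_valP : bochner_val \in bochner }.

HB.instance Definition _ := [isSub for bochner_val].
HB.instance Definition _ := [Choice of bochner_fun by <:].
HB.instance Definition _ := [SubChoice_isSubLmodule of bochner_fun by <:].

(* L1 is the quotient of the Bochner integrable functions by almost everywhere
   equality, normed by the integral of the pointwise norm (L1_normE). *)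
Definition ae_null : {pred bochner_fun} :=
  mem [set f : bochner_fun | {ae mu, forall t, f t = 0}].

Lemma ae_null_submod_closed : submod_closed ae_null.
Proof.
split=> [|a f g]; first by rewrite inE; exact: aeW.
rewrite !inE => f0 g0; apply: filterS2 f0 g0 => t f0 g0.
by rewrite [LHS](_ : _ = a *: f t + g t)// f0 g0 scaler0 addr0.
Qed.

HB.instance Definition _ :=
  GRing.isSubmodClosed.Build R bochner_fun ae_null ae_null_submod_closed.

Definition L1 : Type := Quotient.quot ae_null.

HB.instance Definition _ := Choice.on L1.
HB.instance Definition _ := EqQuotient.on L1.
HB.instance Definition _ := GRing.Zmodule.on L1.
HB.instance Definition _ := ZmodQuotient.on L1.

Local Open Scope quotient_scope.

(* The function chosen to represent a class; it matters only almost
   everywhere. *)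
Definition L1_fun (f : L1) : bochner_fun := repr f.
Coercion L1_fun : L1 >-> bochner_fun.

Lemma L1_eqP (f g : L1) : f = g <-> {ae mu, forall t, f t = g t}.
Proof.
have -> : (f = g) <-> (repr f - repr g \in ae_null).
  rewrite Quotient.idealrBE !reprK; exact: (rwP eqP).
rewrite inE; split; apply: filterS => t.
  by move=> fg0; apply/eqP; rewrite -subr_eq0; apply/eqP.
by move=> fg; rewrite [LHS](_ : _ = f t - g t)// fg subrr.
Qed.

Lemma L1_piE (f : bochner_fun) : {ae mu, forall t, (\pi_L1 f : L1) t = f t}.
Proof.
have : repr (\pi_L1 f) - f \in ae_null by rewrite Quotient.idealrBE reprK.
rewrite inE; apply: filterS => t fg0.
by apply/eqP; rewrite -subr_eq0; apply/eqP.
Qed.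

Lemma L1_addE (f g : L1) : {ae mu, forall t, (f + g : L1) t = f t + g t}.
Proof.
have -> : f + g = \pi_L1 (repr f + repr g) by rewrite pi_addr !reprK.
exact: L1_piE.
Qed.

Definition L1_scale (a : R) (f : L1) : L1 := \pi_L1 (a *: repr f).

Let scaleE a f : {ae mu, forall t, L1_scale a f t = a *: f t}.
Proof. exact: L1_piE. Qed.

Let scaleA a b f : L1_scale a (L1_scale b f) = L1_scale (a * b) f.
Proof.
apply/L1_eqP; apply: filterS3 (scaleE a (L1_scale b f)) (scaleE b f)
  (scaleE (a * b) f) => t -> -> ->.
by rewrite scalerA.
Qed.

Let scale1 : left_id 1 L1_scale.
Proof.
by move=> f; apply/L1_eqP; apply: filterS (scaleE 1 f) => t ->; rewrite scale1r.
Qed.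

Let scaleDr : right_distributive L1_scale +%R.
Proof.
move=> a f g; apply/L1_eqP.
near=> t.
rewrite (near (scaleE a (f + g)) t)// (near (L1_addE f g) t)//.
rewrite (near (L1_addE (L1_scale a f) (L1_scale a g)) t)//.
by rewrite (near (scaleE a f) t)// (near (scaleE a g) t)// scalerDr.
Unshelve. all: by end_near. Qed.

Let scaleDl f : {morph L1_scale^~ f : a b / a + b}.
Proof.
move=> a b /=; apply/L1_eqP; near=> t.
rewrite (near (scaleE (a + b) f) t)//.
rewrite (near (L1_addE (L1_scale a f) (L1_scale b f)) t)//.
by rewrite (near (scaleE a f) t)// (near (scaleE b f) t)// scalerDl.
Unshelve. all: by end_near. Qed.

HB.instance Definition _ := GRing.Zmodule_isLmodule.Build R L1
  scaleA scale1 scaleDr scaleDl.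

Lemma L1_scaleE a (f : L1) : {ae mu, forall t, (a *: f : L1) t = a *: f t}.
Proof. exact: scaleE. Qed.

Definition L1_norm (f : L1) : R := fine (\int[mu]_t `|f t|%:E).

Lemma L1_integrable (f : L1) : bochner_integrable mu f.
Proof. by have := bochner_valP (repr f); rewrite inE. Qed.

Let normE (f : L1) : (L1_norm f)%:E = (\int[mu]_t `|f t|%:E)%E.
Proof.
rewrite fineK// ge0_fin_numE ?(L1_integrable f).2//.
by apply: integral_ge0 => t _; rewrite lee_fin.
Qed.

Let ler_normD (f g : L1) : L1_norm (f + g) <= L1_norm f + L1_norm g.
Proof.
rewrite -lee_fin EFinD !normE.
apply: le_trans (integral_normD (L1_integrable f).1 (L1_integrable g).1).
rewrite le_eqVlt; apply/orP; left; apply/eqP.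
apply: ge0_integral_ae_ext => [t|t|]; rewrite ?lee_fin//.
by apply: filterS (L1_addE f g) => t ->.
Qed.

Let normZ a (f : L1) : L1_norm (a *: f) = `|a| * L1_norm f.
Proof.
apply: EFin_inj; rewrite EFinM !normE -(integral_normZ a (L1_integrable f).1).
apply: ge0_integral_ae_ext => [t|t|]; rewrite ?lee_fin//.
by apply: filterS (L1_scaleE a f) => t ->.
Qed.

Let norm0_eq0 (f : L1) : L1_norm f = 0 -> f = 0.
Proof.
move=> f0; apply/L1_eqP.
have /(integral_norm_eq0 (L1_integrable f).1) : (\int[mu]_t `|f t|%:E = 0)%E.
  by rewrite -normE f0.
have -> : 0 = \pi_L1 0 :> L1 by rewrite piE.
by apply: filterS2 (L1_piE 0) => t -> ->.
Qed.

HB.instance Definition _ := Lmodule_isNormed.Build R L1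
  ler_normD normZ norm0_eq0.

Lemma L1_normE (f : L1) : `|f|%:E = (\int[mu]_t `|f t|%:E)%E.
Proof. exact: normE. Qed.

End bochner_fun.

Arguments L1 {d T R} X mu.

Section weak.
Context (R : numFieldType) (E : normedModType R).

Definition dual := {phi : {linear E -> R^o} | continuous phi}.

(* Supremum of the initial topologies of the elements of the dual. *)
Definition weak : Type := sup_topology (fun phi : dual =>
  Topological.class (initial_topology (sval phi : E -> R^o))).

HB.instance Definition _ := Topological.on weak.

Lemma weak_cvgP (F : set_system E) (x : E) : Filter F ->
  F --> (x : weak) <-> forall phi : dual, sval phi @ F --> sval phi x.
Proof.
move=> FF; rewrite cvg_sup; split=> Fx phi.
- move=> A phixA; apply: (Fx phi).
  exact: (@initial_continuous _ _ (sval phi : E -> R^o) x A phixA).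
- move=> A; rewrite (@nbhsE (initial_topology (sval phi : E -> R^o))).
  move=> -[_ [[C oC <-] Cx] CA]; apply: filterS CA _.
  by apply: (Fx phi); exact: open_nbhs_nbhs.
Qed.

End weak.

Definition convex_hull (R : numDomainType) (E : lmodType R) (A : set E) :
    set E :=
  smallest (@convex_set R E) A.

Section equi_integrable.
Context d (T : measurableType d) (R : realType) (X : normedModType R).
Variables (mu : {measure set T -> \bar R}) (H : set (L1 X mu)).

Definition uniformly_integrable :=
  forall e : R, 0 < e -> exists2 delta : R, 0 < delta &
    forall f, H f -> forall B, measurable B -> (mu B < delta%:E)%E ->
    (\int[mu]_(t in B) `|f t|%:E < e%:E)%E.

(* The covering sets are those of positive index; [A 0] is the conventional
   empty set and [a 0] is unused. *)
Definition equi_integrable :=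
  exists A : (set T)^nat,
    [/\ A 0%N = set0,
        forall n, measurable (A n) /\ (mu (A n) < +oo)%E,
        forall n, A n `<=` A n.+1 &
        \bigcup_n A n = setT] /\
    uniformly_integrable /\
    exists a : R^nat, [/\ forall n, 0 <= a n, cvgn [normed series a] &
      forall f, H f -> forall n,
        (\int[mu]_(t in A n.+1 `\` A n) `|f t|%:E <= (a n.+1)%:E)%E].

End equi_integrable.

(* Main.v *)
Require Import Defs.
From HB Require Import structures.
From mathcomp Require Import all_boot all_order all_algebra generic_quotient.
From mathcomp Require Import all_classical all_reals all_analysis measurable_realfun.
From mathcomp Require Import ring lra.

(** Everything goes through one property of the bounded set [H], called
    [tail_hulls_meet]: for every sequence [f] in [H] some [g] is a norm limit of
    convex combinations of every tail of [f].

    For a bounded set of any Banach space this property is equivalent to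
    relative weak compactness. A weak cluster point of [f] is such a [g] by
    Mazur's theorem ([precompact_tail_hulls_meet]). Conversely
    ([tail_hulls_meet_precompact]), an ultrafilter on the weak closure of [H]
    defines an element [L] of the bidual; if [L] were at positive distance from
    the space, Helly's theorem would let one choose alternately functionals
    [phi_m] of norm at most one and elements [f_n] of [H] with [phi_m (f_i) = 0] for
    [i < m] and [phi_m (f_n)] bounded below for [m <= n], and no [g] could be
    close to convex combinations of all the tails.

    In [L^1], equi-integrability means that the integrals of the norms of the
    elements of [H] over [B] are uniformly small when the integral of [w] over
    [B] is small, where [w] is a fixed positive integrable density; this single
    condition covers both uniform integrability and the small tails along a
    coverage. It follows from [tail_hulls_meet] by a gliding hump argument
    ([tail_hulls_meet_weighted_ui]): otherwise some sequence in [H] would look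
    like the basis of [l^1] on small disjoint sets, and averages of its tails
    would not shrink there. Together with the almost everywhere convergence of
    fast norm convergent sequences this shows that relative weak compactness
    implies the condition on norm convergence, which trivially implies the one
    on weak convergence.

    To close the circle let [g_n] be convex combinations of the tails of [f]
    converging weakly to [G t] at almost every [t]. Then [G] is measurable,
    because at each point it is the limit of its best approximants among
    countably many averages of the [g_n] and the distance to [G t] can be
    computed from these averages alone ([strongly_measurable_weak_limit]). Given
    a functional [phi] on [L^1], the Radon-Nikodym densities of the charges
    [B |-> phi (\1_B (g_n - G))] are of the form [l (g_n t - G t)] with a
    functional [l] on [X] of norm at most one that depends on [t]
    ([functional_disintegration]); they tend to zero almost everywhere, so that
    uniform integrability gives [phi (g_n) --> phi G], as in Vitali's theorem
    ([weak_vitali]). Thus [g_n] converges weakly to [G] in [L^1], and by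
    separation [G] is the element required by [tail_hulls_meet]. *)

Set Implicit Arguments.
Unset Strict Implicit.
Unset Printing Implicit Defensive.

Import Order.TTheory GRing.Theory Num.Theory.
Import numFieldNormedType.Exports.

Local Open Scope classical_set_scope.
Local Open Scope ring_scope.

(** * Sublinear functionals and linear functionals below them *)

Section mazur_orlicz.
Context (R : realType) (V : lmodType R).
Implicit Types (p l : V -> R) (x y : V) (K : set (V * R)).

Definition sublinear p :=
  (forall x y, p (x + y) <= p x + p y) /\
  (forall (t : R) x, 0 <= t -> p (t *: x) = t * p x).

Lemma sublinear0 p : sublinear p -> p 0 = 0.
Proof. by move=> [_ pZ]; rewrite -(scale0r 0) pZ// mul0r. Qed.

Lemma sublinear_ge p x : sublinear p -> - p (- x) <= p x.
Proof.
by move=> sp; have := sp.1 x (- x); rewrite subrr sublinear0//; lra.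
Qed.

Definition positive_cone K := [/\ K (0, 0), forall u v, K u -> K v -> K (u + v) &
  forall (t : R) u, 0 < t -> K u -> K (t *: u.1, t * u.2)].

(** The infimal convolution of [q] with the constraints in [K]: a linear
    functional below it is below [q] and, on the first components of [K], above
    the second ones. *)
Definition inf_shift q K y := inf [set q (y + u.1) - u.2 | u in K].

Section inf_shift.
Variables (q : V -> R) (K : set (V * R)).
Hypotheses (sq : sublinear q) (cK : positive_cone K)
  (qK : forall u, K u -> u.2 <= q u.1).

Let lb y : has_lbound [set q (y + u.1) - u.2 | u in K].
Proof.
exists (- q (- y)) => _ [u /qK Ku <-].
have := sq.1 (- y) (y + u.1); rewrite addKr => ?.
lra.
Qed.

Let K0 : K (0, 0). Proof. by case: cK. Qed.

Lemma inf_shift_le y u : K u -> inf_shift q K y <= q (y + u.1) - u.2.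
Proof. by move=> Ku; apply: (ge_inf (lb y)); exists u. Qed.

Lemma inf_shift_leq y : inf_shift q K y <= q y.
Proof. by apply: (le_trans (inf_shift_le y K0)); rewrite addr0 subr0. Qed.

Lemma le_inf_shift y (a : R) :
  (forall u, K u -> a <= q (y + u.1) - u.2) -> a <= inf_shift q K y.
Proof.
move=> h; apply: lb_le_inf; first by exists (q (y + 0) - 0), (0, 0).
by move=> _ [u Ku <-]; exact: h.
Qed.

Lemma sublinear_inf_shift : sublinear (inf_shift q K).
Proof.
case: cK => _ KD KZ.
have Z_le (t : R) x : 0 < t -> inf_shift q K (t *: x) <= t * inf_shift q K x.
  move=> t0; rewrite -ler_pdivrMl//; apply: le_inf_shift => u Ku.
  rewrite ler_pdivrMl//.
  apply: (le_trans (inf_shift_le _ (KZ _ _ t0 Ku))) => /=.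
  by rewrite -scalerDr (sq.2 _ _ (ltW t0)) mulrBr.
split=> [x y|t x].
  rewrite -lerBlDr; apply: le_inf_shift => u Ku.
  rewrite lerBlDr -lerBlDl; apply: le_inf_shift => v Kv.
  rewrite lerBlDr.
  apply: (le_trans (inf_shift_le _ (KD _ _ Ku Kv))) => /=.
  have := sq.1 (x + u.1) (y + v.1); rewrite addrACA => ?; lra.
rewrite le_eqVlt => /predU1P[<-|t0].
  rewrite scale0r mul0r; apply/eqP; rewrite eq_le; apply/andP; split.
    by rewrite -(sublinear0 sq) inf_shift_leq.
  by apply: le_inf_shift => u /qK; rewrite add0r subr_ge0.
apply/eqP; rewrite eq_le Z_le//=.
rewrite -ler_pdivlMl//; apply: le_trans (Z_le _ _ _); rewrite ?invr_gt0//.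
by rewrite scalerA mulVf ?gt_eqF// scale1r.
Qed.

End inf_shift.

(** A minimal sublinear functional is linear: otherwise the infimal shift along
    the ray of [x] would be strictly smaller at [- x]. *)
Lemma exists_scalar_le p : sublinear p ->
  exists2 l, scalar l & forall x, l x <= p x.
Proof.
move=> sp.
pose S := {q | sublinear q /\ forall x, q x <= p x}.
pose r : rel S := fun q q' => `[< forall x, sval q' x <= sval q x >].
have [||||q qmin] := @Zorn S r.
- by move=> q; apply/asboolP.
- move=> q1 q2 q3 /asboolP h12 /asboolP h23; apply/asboolP => x.
  exact: le_trans (h23 x) (h12 x).
- move=> [q1 h1] [q2 h2] /asboolP /= h12 /asboolP /= h21; apply: eq_exist => /=.
  by apply/funext => x; apply/eqP; rewrite eq_le h12 h21.
- move=> A tA; have [A0|/set0P[q0 Aq0]] := eqVneq A set0.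
    by exists (exist _ p (conj sp (fun=> lexx _))) => s; rewrite A0.
  pose B x := [set sval q x | q in A].
  have lbB x : has_lbound (B x).
    exists (- p (- x)) => _ [[q [sq qp]] _ <-] /=.
    by apply: le_trans (sublinear_ge x sq); rewrite lerN2.
  have B0 x : B x !=set0 by exists (sval q0 x), q0.
  have Ble x q : A q -> inf (B x) <= sval q x.
    by move=> Aq; apply: (ge_inf (lbB x)); exists q.
  have leB x a : (forall q, A q -> a <= sval q x) -> a <= inf (B x).
    by move=> h; apply: lb_le_inf => // _ [q Aq <-]; exact: h.
  have sB : sublinear (fun x => inf (B x)).
    split=> [x y|t x t0].
      rewrite -lerBlDr; apply: (leB) => q1 Aq1.
      rewrite lerBlDr -lerBlDl; apply: (leB) => q2 Aq2.
      rewrite lerBlDr.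
      have [/asboolP h|/asboolP h] := tA _ _ Aq1 Aq2.
        apply: (le_trans (Ble _ _ Aq2)).
        apply: (le_trans ((svalP q2).1.1 _ _)).
        by rewrite addrC lerD2l.
      apply: (le_trans (Ble _ _ Aq1)).
      apply: (le_trans ((svalP q1).1.1 _ _)).
      by rewrite addrC lerD2r.
    move: t0; rewrite le_eqVlt => /predU1P[<-|t0].
      rewrite mul0r scale0r; apply/eqP; rewrite eq_le.
      apply/andP; split; last first.
        by apply: (leB) => q _; rewrite (sublinear0 (svalP q).1).
      by apply: (le_trans (Ble _ _ Aq0)); rewrite (sublinear0 (svalP q0).1).
    apply/eqP; rewrite eq_le; apply/andP; split.
      rewrite -ler_pdivrMl//; apply: (leB) => q Aq; rewrite ler_pdivrMl//.
      by rewrite -((svalP q).1.2 _ _ (ltW t0)) Ble.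
    apply: (leB) => q Aq; rewrite ((svalP q).1.2 _ _ (ltW t0)).
    by rewrite ler_pM2l// Ble.
  have Bp x : inf (B x) <= p x.
    by apply: (le_trans (Ble x _ Aq0)); exact: (svalP q0).2.
  exists (exist _ (fun x => inf (B x)) (conj sB Bp)) => q Aq.
  by apply/asboolP => x /=; exact: Ble.
case: q qmin => q [sq qp] qmin; exists q => //.
have qN x : q (- x) = - q x.
  pose K := [set (t *: x, t * q x) | t in [set t : R | 0 <= t]].
  have cK : positive_cone K.
    split; first by exists 0; rewrite /= ?scale0r ?mul0r.
      move=> _ _ [s s0 <-] [t t0 <-]; exists (s + t); first exact: addr_ge0.
      by rewrite scalerDl mulrDl.
    move=> s _ s0 [t t0 <-]; exists (s * t); first by rewrite /= mulr_ge0// ltW.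
    by rewrite /= scalerA mulrA.
  have qK u : K u -> u.2 <= q u.1.
    by move=> [t t0 <-] /=; rewrite sq.2.
  have sK := sublinear_inf_shift sq cK qK.
  have Kq := inf_shift_leq sq cK qK.
  have /(congr1 sval) /= qE := qmin (exist _ _ (conj sK (fun x => le_trans (Kq x) (qp x))))
    (asboolT Kq).
  apply/eqP; rewrite eq_le; apply/andP; split; last first.
    by rewrite lerNl sublinear_ge.
  have K1 : K (x, q x) by exists 1; rewrite /= ?scale1r ?mul1r.
  have := inf_shift_le sq qK (- x) K1.
  by rewrite qE /= addNr sublinear0// sub0r.
have qD x y : q (x + y) = q x + q y.
  apply/eqP; rewrite eq_le sq.1/= -lerN2 -qN opprD.
  by rewrite (le_trans (sq.1 _ _))// !qN opprD.
move=> a x y; rewrite qD; congr (_ + _).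
have [a0|a0] := leP 0 a; first by rewrite sq.2.
rewrite -[a in LHS]opprK scaleNr qN sq.2 ?oppr_ge0 ?ltW//.
by rewrite mulNr opprK.
Qed.

(** The Mazur-Orlicz form of the Hahn-Banach theorem: lower bounds prescribed
    on a cone can be met by a linear functional below [q] as soon as [q] itself
    meets them. *)
Lemma exists_scalar_between q K : sublinear q -> positive_cone K ->
  (forall u, K u -> u.2 <= q u.1) ->
  exists l, [/\ scalar l, forall x, l x <= q x & forall u, K u -> u.2 <= l u.1].
Proof.
move=> sq cK qK.
have [l ll lp] := exists_scalar_le (sublinear_inf_shift sq cK qK).
exists l; split=> // [x|u Ku]; first exact: le_trans (inf_shift_leq sq cK qK x).
have := inf_shift_le sq qK (- u.1) Ku; rewrite addNr sublinear0//.
move=> /(le_trans (lp _)).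
have -> : l (- u.1) = - l u.1.
  have l0 : l 0 = 0 by have := ll (-1) 0 0; rewrite scaler0 addr0; lra.
  by have := ll (-1) u.1 0; rewrite addr0 scaleN1r l0 => ->; lra.
by rewrite sub0r lerN2.
Qed.

End mazur_orlicz.

Section functional_theory.
Context (R : realType) (V : lmodType R).
Variables (l : V -> R) (ll : scalar l).

Lemma functional0 : l 0 = 0.
Proof. by have := ll (-1) 0 0; rewrite scaler0 addr0; lra. Qed.
Lemma functionalZ a x : l (a *: x) = a * l x.
Proof. by have := ll a x 0; rewrite !addr0 functional0 addr0. Qed.
Lemma functionalD x y : l (x + y) = l x + l y.
Proof. by have := ll 1 x y; rewrite scale1r mul1r. Qed.
Lemma functionalN x : l (- x) = - l x.
Proof. by rewrite -scaleN1r functionalZ mulN1r. Qed.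
Lemma functionalB x y : l (x - y) = l x - l y.
Proof. by rewrite functionalD functionalN. Qed.
Lemma functional_sum I (r : seq I) (P : pred I) (F : I -> V) :
  l (\sum_(i <- r | P i) F i) = \sum_(i <- r | P i) l (F i).
Proof. exact: (big_morph l functionalD functional0). Qed.

End functional_theory.

(** * Separation and interpolation in a normed space *)

Section bounded_functionals.
Context (R : realType) (E : normedModType R).
Implicit Types (l : E -> R) (x y : E) (C : set E).

Definition bounded_functional (c : R) l :=
  [/\ 0 <= c, scalar l & forall x, `|l x| <= c * `|x|].

Lemma sublinear_norm : sublinear (fun x : E => `|x|).
Proof. by split=> [|t x t0]; [exact: ler_normD|rewrite normrZ ger0_norm]. Qed.

Lemma scalar_le_norm l : scalar l -> (forall x, l x <= `|x|) ->
  bounded_functional 1 l.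
Proof.
move=> ll lx; split=> // x; rewrite mul1r ler_norml lx andbT.
by rewrite lerNl -functionalN// -normrN.
Qed.

Lemma convex_setP (C : set (convex_lmodType E)) :
  convex_set C <-> forall (x y : E) (t : R), C x -> C y -> 0 <= t -> t <= 1 ->
    C (t *: x + (1 - t) *: y).
Proof.
split=> [cC x y t Cx Cy t0 t1|cC x y t /set_mem Cx /set_mem Cy].
  have := cC x y (Itv01 t0 t1) (mem_set Cx) (mem_set Cy); rewrite inE.
  by [].
by apply/mem_set; exact: cC.
Qed.

(** Hahn-Banach separation. The prescribed bounds live on the cone spanned by
    the pairs [(c - x, d)], and the hypothesis on the distance says that the
    norm meets them. *)
Lemma convex_separation C x (d : R) :
  convex_set (C : set (convex_lmodType E)) -> 0 <= d ->
  (forall c, C c -> d <= `|c - x|) ->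
  exists2 l, bounded_functional 1 l & forall c, C c -> l x + d <= l c.
Proof.
move=> /convex_setP cC d0 Cd.
have [->|/set0P[c0 Cc0]] := eqVneq C set0.
  exists (fun=> 0) => //; split=> [//|a u v|y]; first by rewrite mulr0 addr0.
  by rewrite normr0 mul1r.
pose K := [set (z.1 *: (z.2 - x), z.1 * d) | z in [set z : R * E | 0 <= z.1 /\ C z.2]].
have cK : positive_cone K.
  split.
  - by exists (0, c0) => //=; rewrite scale0r mul0r.
  - move=> _ _ [[s c] /= [s0 Cc] <-] [[t c'] /= [t0 Cc'] <-].
    have [st0|st0] := eqVneq (s + t) 0.
      have -> : s = 0 by lra.
      have -> : t = 0 by lra.
      by exists (0, c) => //=; rewrite !scale0r !mul0r !addr0.
    have stp : 0 < s + t by rewrite lt_neqAle eq_sym st0 addr_ge0.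
    exists (s + t, s / (s + t) *: c + (1 - s / (s + t)) *: c') => /=.
      split; first exact: ltW.
      apply: cC => //; first by rewrite divr_ge0// ltW.
      by rewrite ler_pdivrMr// mul1r lerDl.
    rewrite mulrDl; congr (_, _).
    rewrite scalerBr scalerDr !scalerA mulrBr mulr1 mulrCA divff// mulr1.
    rewrite (addrC s t) addrK !scalerBr scalerDl opprD.
    by rewrite /= [RHS]addrACA; congr (_ + _); rewrite addrC.
  - move=> s _ s0 [[t c] /= [t0 Cc] <-]; exists (s * t, c) => /=.
      by split=> //; rewrite mulr_ge0// ltW.
    by rewrite scalerA mulrA.
have KN u : K u -> u.2 <= `|u.1|.
  move=> [[t c] /= [t0 Cc] <-] /=; rewrite normrZ ger0_norm//.
  by rewrite ler_wpM2l// Cd.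
have [l [ll lN lK]] := exists_scalar_between sublinear_norm cK KN.
exists l; first exact: scalar_le_norm.
move=> c Cc; have /lK/= : K (c - x, d).
  by exists (1, c) => //=; rewrite scale1r mul1r.
by rewrite functionalB//; lra.
Qed.

Lemma exists_norming x : exists2 l, bounded_functional 1 l & l x = `|x|.
Proof.
have [||c ->|l bl lx] := @convex_separation [set x] 0 `|x|.
- apply/convex_setP => _ _ t -> -> _ _.
  by rewrite -scalerDl addrC subrK scale1r.
- exact: normr_ge0.
- by rewrite subr0.
exists l => //; have [_ ll lN] := bl.
have := lx x erefl; rewrite functional0// add0r => xlx.
apply/eqP; rewrite eq_le xlx andbT.
by rewrite (le_trans (ler_norm _))// (le_trans (lN _)) ?mul1r.
Qed.

(** Values prescribed on a sequence of vectors extend to a functional of norm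
    at most one as soon as the norm bound holds for the integer combinations,
    here differences of two sums of vectors of the sequence: real combinations
    are approximated by rational ones. *)
Lemma functional_interpolation (x : nat -> E) (a : nat -> R) :
  (forall s s' : seq nat, \sum_(k <- s) a k - \sum_(k <- s') a k <=
     `|\sum_(k <- s) x k - \sum_(k <- s') x k|) ->
  exists2 l, bounded_functional 1 l & forall k, l (x k) = a k.
Proof.
move=> ax.
pose S (l : seq (R * nat)) := \sum_(p <- l) p.1 *: x p.2.
pose A (l : seq (R * nat)) := \sum_(p <- l) p.1 * a p.2.
pose K := [set (S l, A l) | l in setT].
have cK : positive_cone K.
  split.
  - by exists [::] => //; rewrite /S /A !big_nil.
  - move=> _ _ [l1 _ <-] [l2 _ <-]; exists (l1 ++ l2) => //.
    by rewrite /S /A !big_cat.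
  - move=> t _ _ [l _ <-]; exists [seq (t * p.1, p.2) | p <- l] => //=.
    rewrite /S /A !big_map scaler_sumr mulr_sumr; congr (_, _).
      by apply: eq_bigr => p _; rewrite scalerA.
    by apply: eq_bigr => p _; rewrite mulrA.
have KN u : K u -> u.2 <= `|u.1|.
  move=> [l _ <-] /=.
  pose D := \sum_(p <- l) (`|x p.2| + `|a p.2|).
  suff nAS (n : nat) : n%:R * (A l - `|S l|) <= D.
    rewrite -subr_le0 leNgt; apply/negP => AS0.
    have /archi_boundP : 0 <= D / (A l - `|S l|).
      by apply: divr_ge0 (ltW AS0); apply: sumr_ge0 => p _; rewrite addr_ge0.
    by rewrite ltr_pdivrMr// ltNge nAS.
  pose z (r : R) : R := (Num.truncn (n%:R * r))%:R - (Num.truncn (- (n%:R * r)))%:R.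
  have zr r : `|z r - n%:R * r| <= 1.
    rewrite /z; set m := n%:R * r.
    have [m0|m0] := leP 0 m.
      have /andP[h1 h2] := Num.Theory.truncn_itv m0.
      have /eqP -> : Num.truncn (- m) == 0%N.
        rewrite -leqn0 leqNgt Num.Theory.truncn_gt_nat -ltNge.
        by rewrite (le_lt_trans _ ltr01)// oppr_le0.
      rewrite -natr1 in h2.
      by rewrite subr0 ler_norml; apply/andP; split; lra.
    have m0' : 0 <= - m by rewrite oppr_ge0 ltW.
    have /andP[h1 h2] := Num.Theory.truncn_itv m0'.
    have /eqP -> : Num.truncn m == 0%N.
      rewrite -leqn0 leqNgt Num.Theory.truncn_gt_nat -ltNge.
      exact: lt_trans m0 ltr01.
    rewrite -natr1 in h2.
    by rewrite sub0r ler_norml; apply/andP; split; lra.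
  pose s := flatten [seq nseq (Num.truncn (n%:R * p.1)) p.2 | p <- l].
  pose s' := flatten [seq nseq (Num.truncn (- (n%:R * p.1))) p.2 | p <- l].
  have sumE (V : zmodType) (y : nat -> V) (f : R -> nat) :
      \sum_(k <- flatten [seq nseq (f p.1) p.2 | p <- l]) y k =
      \sum_(p <- l) y p.2 *+ f p.1.
    rewrite big_flatten big_map; apply: eq_bigr => p _.
    by rewrite big_nseq; elim: (f p.1) => //= k IH; rewrite IH mulrS.
  have := ax s s'; rewrite /s /s'.
  rewrite (sumE _ a (fun r => Num.truncn (n%:R * r))).
  rewrite (sumE _ a (fun r => Num.truncn (- (n%:R * r)))).
  rewrite (sumE _ x (fun r => Num.truncn (n%:R * r))).
  rewrite (sumE _ x (fun r => Num.truncn (- (n%:R * r)))).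
  rewrite -!sumrB.
  have -> : \sum_(p <- l) (a p.2 *+ Num.truncn (n%:R * p.1) -
      a p.2 *+ Num.truncn (- (n%:R * p.1))) = \sum_(p <- l) z p.1 * a p.2.
    by apply: eq_bigr => p _; rewrite /z mulrBl !mulr_natl.
  have -> : \sum_(p <- l) (x p.2 *+ Num.truncn (n%:R * p.1) -
      x p.2 *+ Num.truncn (- (n%:R * p.1))) = \sum_(p <- l) z p.1 *: x p.2.
    by apply: eq_bigr => p _; rewrite /z scalerBl !scaler_nat.
  have h1 : n%:R * A l <= \sum_(p <- l) z p.1 * a p.2 + \sum_(p <- l) `|a p.2|.
    rewrite /A mulr_sumr -big_split/=; apply: ler_sum => p _.
    rewrite -lerBlDl mulrA -mulrBl (le_trans (ler_norm _))// normrM.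
    by rewrite ler_piMl// distrC zr.
  have h2 : `|\sum_(p <- l) z p.1 *: x p.2| <=
      n%:R * `|S l| + \sum_(p <- l) `|x p.2|.
    have -> : n%:R * `|S l| = `|\sum_(p <- l) (n%:R * p.1) *: x p.2|.
      under eq_bigr do rewrite -scalerA.
      by rewrite -scaler_sumr normrZ normr_nat.
    rewrite -lerBlDl; apply: (le_trans (lerB_dist _ _)); rewrite -sumrB.
    apply: (le_trans (ler_norm_sum _ _ _)); apply: ler_sum => p _.
    by rewrite -scalerBl normrZ ler_piMl.
  rewrite /D big_split/=; lra.
have [l [ll lN lK]] := exists_scalar_between sublinear_norm cK KN.
exists l; first exact: scalar_le_norm.
move=> k; apply/eqP; rewrite eq_le; apply/andP; split; last first.
  have /lK : K (x k, a k) by exists [:: (1, k)] => //; rewrite /S /A !big_seq1 scale1r mul1r.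
  by [].
have /lK/= : K (- x k, - a k).
  by exists [:: (-1, k)] => //; rewrite /S /A !big_seq1 scaleN1r mulN1r.
by rewrite functionalN// lerN2.
Qed.

End bounded_functionals.

(** * Averages of a sequence *)

Section averages.
Context (R : realType) (E : normedModType R).
Implicit Types (x : nat -> E) (s : seq nat).

Definition average x s := (size s)%:R^-1 *: \sum_(k <- s) x k.

(** Indices may repeat in [s], so that averages are exactly the convex
    combinations with rational weights. *)
Lemma convex_hull_average x n h (e : R) : 0 < e ->
  convex_hull [set x k | k in [set k | (n <= k)%N]] h ->
  exists s, [/\ s != [::], all (leq n) s & `|h - average x s| < e].
Proof.
move=> e0 hh; move: h hh e e0.
pose P := [set h : E | forall e : R, 0 < e ->
  exists s, [/\ s != [::], all (leq n) s & `|h - average x s| < e]].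
suff : convex_hull [set x k | k in [set k | (n <= k)%N]] `<=` P.
  by move=> + h hh; exact.
apply: smallest_sub; last first.
  move=> _ [k nk <-] e e0; exists [:: k]; split=> //=; first by rewrite andbT.
  by rewrite /average big_seq1/= invr1 scale1r subrr normr0.
apply/convex_setP => h h' t Ph Ph' t0 t1 e e0.
have e20 : 0 < e / 2 by rewrite divr_gt0.
have [s [s0 ns hs]] := Ph _ e20; have [s' [s'0 ns' hs']] := Ph' _ e20.
set A := average x s in hs; set B := average x s' in hs'.
pose M := `|A| + `|B|.
have M0 : 0 <= M by rewrite addr_ge0.
pose N := (Num.bound (M / (e / 2))).+1.
have NM : M < e / 2 * N%:R.
  rewrite mulrC -ltr_pdivrMr//.
  apply: (lt_trans (archi_boundP _)); first by rewrite divr_ge0// ltW.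
  by rewrite ltr_nat.
pose p := Num.truncn (t * N%:R).
have tN0 : 0 <= t * N%:R by rewrite mulr_ge0.
have /andP[p1 p2] := Num.Theory.truncn_itv tN0; rewrite -/p in p1 p2.
have N0 : 0 < N%:R :> R by rewrite ltr0n.
have pN : (p <= N)%N.
  by rewrite -(ler_nat R) (le_trans p1)// ler_piMl// ltW.
have ss : (0 < size s)%N by rewrite lt0n size_eq0.
have ss' : (0 < size s')%N by rewrite lt0n size_eq0.
have sumE r m : \sum_(k <- flatten (nseq m r)) x k = (\sum_(k <- r) x k) *+ m.
  by elim: m => [|m IH]; rewrite ?big_nil// big_cat/= IH mulrS.
have sizeE r m : size (flatten (nseq m r) : seq nat) = (m * size r)%N.
  by elim: m => //= m IH; rewrite size_cat IH mulSn.
have allE r m : all (leq n) r -> all (leq n) (flatten (nseq m r)).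
  by move=> nr; elim: m => //= m IH; rewrite all_cat nr.
pose r := flatten (nseq (p * size s') s) ++ flatten (nseq ((N - p) * size s) s').
have sr : size r = (N * (size s * size s'))%N.
  rewrite size_cat !sizeE -!mulnA (mulnC (size s')) -mulnDl.
  by rewrite subnKC.
pose tau : R := p%:R / N%:R.
have rE : average x r = tau *: A + (1 - tau) *: B.
  have sn0 : (size s)%:R != 0 :> R by rewrite pnatr_eq0 -lt0n.
  have sn0' : (size s')%:R != 0 :> R by rewrite pnatr_eq0 -lt0n.
  have Nn0 : N%:R != 0 :> R by rewrite gt_eqF.
  have -> : average x r = (N * (size s * size s'))%:R^-1 *:
      ((p * size s')%:R *: \sum_(k <- s) x k +
       ((N - p) * size s)%:R *: \sum_(k <- s') x k).
    by rewrite /average sr /r big_cat !sumE !scaler_nat.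
  rewrite scalerDr !scalerA !natrM (natrB _ pN).
  by congr (_ *: _ + _ *: _); rewrite /tau; field; rewrite sn0 sn0' Nn0.
have taut : `|t - tau| * N%:R <= 1.
  rewrite -[X in _ * X](gtr0_norm N0) -normrM mulrBl /tau divfK ?gt_eqF//.
  by rewrite -natr1 in p2; rewrite ler_norml; apply/andP; split; lra.
exists r; split.
- by rewrite -size_eq0 sr -lt0n !muln_gt0 ss ss'.
- by rewrite all_cat !allE.
rewrite rE.
have -> : t *: h + (1 - t) *: h' - (tau *: A + (1 - tau) *: B) =
   (t *: (h - A) + (1 - t) *: (h' - B)) + (t - tau) *: (A - B).
  have -> : t *: h = t *: (h - A) + t *: A by rewrite -scalerDr subrK.
  have -> : (1 - t) *: h' = (1 - t) *: (h' - B) + (1 - t) *: B.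
    by rewrite -scalerDr subrK.
  rewrite [X in X - _]addrACA -[LHS]addrA; congr (_ + _).
  rewrite opprD addrACA -!scalerBl scalerBr; congr (_ + _).
  by rewrite -scaleNr; congr (_ *: _); ring.
apply: (le_lt_trans (ler_normD _ _)).
have -> : e = e / 2 + e / 2 by rewrite -splitr.
apply: ltr_leD.
  apply: (le_lt_trans (ler_normD _ _)); rewrite !normrZ !ger0_norm ?subr_ge0//.
  have [->|tn0] := eqVneq t 0; first by rewrite mul0r add0r subr0 mul1r.
  have tp : 0 < t by rewrite lt_neqAle eq_sym tn0.
  have -> : e / 2 = t * (e / 2) + (1 - t) * (e / 2) by ring.
  apply: ltr_leD; first by rewrite ltr_pM2l.
  by rewrite ler_wpM2l ?subr_ge0// ltW.
rewrite normrZ.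
apply: (@le_trans _ _ (`|t - tau| * M)).
  by rewrite ler_wpM2l// ler_normB.
apply: (le_trans (ler_wpM2l (normr_ge0 _) (ltW NM))).
by rewrite mulrCA ler_piMr// ltW.
Qed.

Lemma average_in_hull x n s : s != [::] -> all (leq n) s ->
  convex_hull [set x k | k in [set k | (n <= k)%N]] (average x s).
Proof.
move=> s0 ns C [/convex_setP cC CS].
have Cx k : (n <= k)%N -> C (x k) by move=> nk; apply: CS; exists k.
case: s s0 ns => // k s _; elim/last_ind: s => [|s j IH] /=.
  by rewrite andbT /average big_seq1 invr1 scale1r; exact: Cx.
rewrite all_rcons => /andP[nk /andP[nj ns]].
have := IH; rewrite /= nk ns => /(_ isT) Ch.
pose t : R := (size s).+1%:R / (size s).+2%:R.
have n0 : (size s).+1%:R != 0 :> R by rewrite pnatr_eq0.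
have n1 : (size s).+2%:R != 0 :> R by rewrite pnatr_eq0.
have -> : average x (k :: rcons s j) = t *: average x (k :: s) + (1 - t) *: x j.
  rewrite /average -rcons_cons -cats1 big_cat big_seq1 size_cat/= addn1 scalerDr; congr (_ + _).
    by rewrite scalerA /t; congr (_ *: _); rewrite mulrAC divff// mul1r.
  by congr (_ *: _); rewrite /t -[X in X - _](divff n1) -mulrBl -natrB// subSnn mul1r.
apply: cC => //; first exact: Cx.
  by rewrite divr_ge0.
by rewrite ler_pdivrMr ?ltr0n// mul1r ler_nat.
Qed.

End averages.

(** * Weak compactness through convex combinations of tails *)

(** Recursive choice where each element may depend on all the previous ones. *)
Lemma history_choice (A : Type) (Q : seq A -> A -> Prop) :
  (forall l, exists a, Q l a) ->
  exists u : nat -> A, forall n, Q (mkseq u n) (u n).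
Proof.
move=> /choice[F QF].
pose L := fix L n := if n is n.+1 then rcons (L n) (F (L n)) else [::].
exists (fun n => F (L n)) => n; suff -> : mkseq (fun n => F (L n)) n = L n by [].
by elim: n => //= n IH; rewrite mkseqS IH.
Qed.

Section weak_topology.
Context (R : realType) (E : normedModType R).
Implicit Types (l : E -> R) (x y : E).

Lemma dual_bounded (phi : dual E) :
  exists c, bounded_functional c (sval phi : E -> R).
Proof.
case: phi => phi cphi; have /linear_bounded_continuous := cphi.
move=> /linear_boundedP/pinfty_ex_gt0[c c0 bc].
exists c; split; [exact: ltW| |exact: bc].
by move=> a u v /=; rewrite linearP.
Qed.

Lemma bounded_dual c l : bounded_functional c l ->
  exists phi : dual E, forall x, sval phi x = l x.
Proof.
move=> [c0 ll lc].
pose L : {linear E -> R^o} := HB.pack (l : E -> R^o)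
  (GRing.isLinear.Build R E R^o *:%R (l : E -> R^o) ll).
have cL : continuous L.
  apply: bounded_linear_continuous; apply/linear_boundedP.
  near=> r => x; apply: (le_trans (lc x)).
  by rewrite ler_wpM2r//; near: r; exact: nbhs_pinfty_ge.
by exists (exist _ L cL).
Unshelve. all: by end_near. Qed.

Lemma weak_nbhs c l x (A : set R) : bounded_functional c l -> nbhs (l x) A ->
  nbhs (x : weak E) (l @^-1` A).
Proof.
move=> /bounded_dual[phi phiE].
have : forall psi : dual E, sval psi @ nbhs (x : weak E) --> sval psi x.
  by apply/weak_cvgP.
move=> /(_ phi).
have -> : (sval phi : E -> R) = l by apply/funext.
by apply.
Qed.

(** Mazur's theorem. *)
Lemma weak_closure_convex (C : set E) x (e : R) :
  convex_set (C : set (convex_lmodType E)) -> closure (C : set (weak E)) x ->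
  0 < e -> exists2 y, C y & `|y - x| < e.
Proof.
move=> cC clx e0; apply: contrapT => nC.
have [y Cy|l bl lC] := @convex_separation _ _ C x e cC (ltW e0).
  by rewrite leNgt; apply/negP => yx; apply: nC; exists y.
have : nbhs (x : weak E) (l @^-1` [set z | z < l x + e]).
  by apply: (weak_nbhs bl); apply: lt_nbhsl; rewrite ltrDl.
move=> /clx[y [/lC ly /=]]; rewrite ltNge.
by move=> /negP; exact.
Qed.

Definition tail_hull (f : nat -> E) (n : nat) : set E :=
  convex_hull [set f k | k in [set k | (n <= k)%N]].

Definition tail_hulls_meet (H : set E) := forall f : nat -> E,
  (forall n, H (f n)) -> exists g : E, forall n (e : R), 0 < e ->
  exists2 h, tail_hull f n h & `|h - g| < e.

Lemma tail_hull_convex f n : convex_set (tail_hull f n : set (convex_lmodType E)).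
Proof.
apply/convex_setP => x y t hx hy t0 t1 C [cC CS].
by move/convex_setP: (cC); apply=> //; [exact: hx|exact: hy].
Qed.

Lemma tail_hull_gen f n k : (n <= k)%N -> tail_hull f n (f k).
Proof. by move=> nk C [_]; apply; exists k. Qed.

Lemma tail_hull_mem f n h (C : set E) : tail_hull f n h ->
  (forall x y t, C x -> C y -> 0 <= t -> t <= 1 -> C (t *: x + (1 - t) *: y)) ->
  (forall k, (n <= k)%N -> C (f k)) -> C h.
Proof.
move=> hh cC Cf; apply: hh; split; first exact/convex_setP.
by move=> _ [k nk <-]; exact: Cf.
Qed.

Lemma precompact_tail_hulls_meet (H : set E) :
  precompact (H : set (weak E)) -> tail_hulls_meet H.
Proof.
rewrite precompactE => cH f Hf.
pose F : set_system (weak E) := (f : nat -> weak E) @ \oo.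
have FF : ProperFilter F by apply: fmap_proper_filter.
have [g [_ cg]] : closure (H : set (weak E)) `&` cluster F !=set0.
  apply: cH; exists 0 => // n _; apply: subset_closure; exact: Hf.
exists g => n e e0; apply: weak_closure_convex e0; first exact: tail_hull_convex.
move=> B gB; apply: cg gB.
by exists n => // k nk; exact: tail_hull_gen.
Qed.

End weak_topology.

Section helly.
Context (R : realType) (E : normedModType R).
Implicit Types (phi psi : E -> R) (x y : E).

(** One dimension at a time: along the evaluation at [z], the admissible values
    [a] form the interval between the numbers [L phi - r c] and
    [L psi + r c'], where [phi z = psi z = 1]. *)
Lemma helly_step (L : (E -> R) -> R) (W : set (E -> R)) (r : R) z :
  (forall c c' t phi psi, bounded_functional c phi -> bounded_functional c' psi ->
     L (t *: phi + psi) = t * L phi + L psi) ->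
  (forall t phi psi, W phi -> W psi -> W (t *: phi + psi)) ->
  0 <= r ->
  (forall c phi, bounded_functional c phi -> W phi -> phi z = 0 ->
     L phi <= r * c) ->
  exists a : R, forall c phi, bounded_functional c phi -> W phi ->
     L phi - a * phi z <= r * c.
Proof.
move=> LD WD r0 Lz.
pose S := [set b | exists c phi, [/\ bounded_functional c phi, W phi, phi z = 1 &
  b = L phi - r * c]].
have L0 c phi : bounded_functional c phi -> L 0 = 0.
  move=> bphi; have := LD _ _ (-1) _ _ bphi bphi.
  by rewrite scaleN1r addNr => ->; ring.
have W0 phi : W phi -> W 0.
  by move=> Wphi; have := WD (-1) _ _ Wphi Wphi; rewrite scaleN1r addNr.
have b0 : bounded_functional 0 (0 : E -> R).
  by split=> // [a u v|x]; rewrite ?mulr0 ?addr0// mul0r normr0.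
have bZ t c phi : bounded_functional c phi ->
    bounded_functional (`|t| * c) (t *: phi).
  move=> [c0 lphi bphi]; split; first by rewrite mulr_ge0.
    by move=> a u v; rewrite /= !fctE lphi /GRing.scale/=; ring.
  move=> x; rewrite /= !fctE /GRing.scale/= normrM -mulrA.
  by rewrite ler_wpM2l.
have bD c c' phi psi : bounded_functional c phi -> bounded_functional c' psi ->
    bounded_functional (c + c') (phi + psi).
  move=> [c0 lphi bphi] [c'0 lpsi bpsi]; split; first exact: addr_ge0.
    by move=> a u v; rewrite /= !fctE lphi lpsi; ring.
  move=> x; rewrite /= !fctE mulrDl (le_trans (ler_normD _ _))//.
  exact: lerD.
have LZ t c phi : bounded_functional c phi -> L (t *: phi) = t * L phi.
  move=> bphi; have := LD _ _ t _ _ bphi b0.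
  by rewrite (L0 _ _ bphi) !addr0.
have LDD c c' phi psi : bounded_functional c phi -> bounded_functional c' psi ->
    L (phi + psi) = L phi + L psi.
  by move=> bphi bpsi; have := LD _ _ 1 _ _ bphi bpsi; rewrite scale1r mul1r.
have WZ t phi : W phi -> W (t *: phi).
  by move=> Wphi; have := WD t _ _ Wphi (W0 _ Wphi); rewrite addr0.
have key b c phi : S b -> bounded_functional c phi -> W phi -> phi z = 1 ->
    b <= L phi + r * c.
  move=> [c' [psi [bpsi Wpsi psiz ->]]] bphi Wphi phiz.
  have bN := bZ (-1) _ _ bphi.
  have := Lz _ _ (bD _ _ _ _ bN bpsi) (WD _ _ _ Wphi Wpsi).
  rewrite (LDD _ _ _ _ bN bpsi) (LZ _ _ _ bphi) !fctE.
  rewrite phiz psiz /GRing.scale/= normrN1 => /(_ _).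
  by move=> /(_ ltac:(ring)); lra.
have Sup b : S b -> has_ubound S.
  move=> [c [phi [bphi Wphi phiz _]]]; exists (L phi + r * c) => b' Sb'.
  exact: (key _ _ _ Sb' bphi Wphi phiz).
exists (sup S) => c phi bphi Wphi.
have [phiz|phiz] := eqVneq (phi z) 0.
  by rewrite phiz mulr0 subr0; exact: Lz.
pose psi := (phi z)^-1 *: phi.
have Wpsi : W psi by exact: WZ.
have bpsi : bounded_functional (`|(phi z)^-1| * c) psi by exact: bZ.
have psiz : psi z = 1 by rewrite /psi fctE /GRing.scale/= mulVf.
have Lpsi : L phi = phi z * L psi.
  by rewrite /psi (LZ _ _ _ bphi) mulrA mulfV// mul1r.
pose b := L psi - r * (`|(phi z)^-1| * c).
have Sb : S b by exists (`|(phi z)^-1| * c), psi.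
have supub : sup S <= L psi + r * (`|(phi z)^-1| * c).
  apply: ge_sup; first by exists b.
  by move=> b' Sb'; exact: key.
have suplb : b <= sup S by apply: ub_le_sup => //; exact: (Sup _ Sb).
rewrite Lpsi mulrC -mulrBl.
have -> : r * c = `|phi z| * (r * (`|(phi z)^-1| * c)).
  by rewrite normfV; field; rewrite normr_eq0.
move: supub suplb; rewrite /b; set D := r * _ => h1 h2.
apply: (le_trans (ler_norm _)); rewrite normrM mulrC ler_wpM2l//.
by rewrite ler_norml; apply/andP; split; lra.
Qed.

(** Helly's theorem: if [L] is small on the functionals that kill the vectors of
    [s], then [L] is close to the evaluation at some vector. *)
Lemma helly (s : seq E) (L : (E -> R) -> R) (r : R) :
  (forall c c' t phi psi, bounded_functional c phi -> bounded_functional c' psi ->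
     L (t *: phi + psi) = t * L phi + L psi) ->
  0 <= r ->
  (forall c phi, bounded_functional c phi -> {in s, forall x, phi x = 0} ->
     L phi <= r * c) ->
  exists y, forall c phi, bounded_functional c phi -> L phi - phi y <= r * c.
Proof.
move=> LD r0; elim: s L LD => [|z s IH] L LD Ls.
  exists 0 => c phi bphi; have [_ lphi _] := bphi.
  by rewrite functional0// subr0; apply: Ls.
pose W phi := {in s, forall x, phi x = 0}.
have WD t phi psi : W phi -> W psi -> W (t *: phi + psi).
  move=> Wp Wq x xs; rewrite [LHS](_ : _ = t * phi x + psi x)//.
  by rewrite Wp// Wq// mulr0 addr0.
have [|a La] := @helly_step L W r z LD WD r0.
  move=> c phi bphi Wphi phiz; apply: Ls => // x.
  by rewrite inE => /predU1P[->|/Wphi].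
have [||y Ly] := IH (fun phi => L phi - a * phi z).
- move=> c c' t phi psi bphi bpsi; rewrite (LD _ _ _ _ _ bphi bpsi) !fctE.
  by rewrite /GRing.scale/=; ring.
- by move=> c phi bphi Wphi; exact: La.
exists (a *: z + y) => c phi bphi; have [_ lphi _] := bphi.
by rewrite (functionalD lphi) (functionalZ lphi) opprD addrA; exact: Ly.
Qed.

End helly.

Section tail_hulls_meet_precompact.
Context (R : realType) (E : normedModType R).
Implicit Types (phi psi : E -> R) (x y : E).

(** Grothendieck's argument. An ultrafilter [F] on the weak closure of [H]
    induces the functional [phi |-> lim (phi @ F)] on the dual. If this
    functional stayed at distance more than [r] from all evaluations, Helly's
    theorem would produce [f_n] in [H] and functionals [phi_m] of norm at most one with
    [phi_m (f_i) = 0] for [i < m] and [phi_m (f_n) > r / 2] for [m <= n]; then no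
    vector would be close to convex combinations of every tail of [f_n]: being
    close to one of them, it would be almost killed by [phi_m] for large [m]. *)
Lemma tail_hulls_meet_precompact (H : set E) :
  (forall u : nat -> E, (forall n, `|u n.+1 - u n| <= 2 ^- n) -> cvgn u) ->
  bounded_set H -> tail_hulls_meet H -> precompact (H : set (weak E)).
Proof.
move=> complE bH meetH.
rewrite precompactE compact_ultra => F FU FH.
have FF : ProperFilter F by exact: ultra_proper.
have [M M0 HM] : exists2 M : R, 0 < M & forall x, H x -> `|x| <= M.
  have [M M0 HM] := pinfty_ex_gt0 bH; by exists M.
pose L phi : R := lim (phi @ F).
have Lcvg c phi : bounded_functional c phi -> phi @ F --> L phi.
  move=> bphi; have [c0 lphi bndphi] := bphi.
  have clphi x : closure (H : set (weak E)) x -> `|phi x| <= c * M.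
    move=> clx; rewrite leNgt; apply/negP => h.
    have : nbhs (x : weak E) (phi @^-1` [set t | c * M < `|t|]).
      apply: (weak_nbhs bphi).
      apply: (@cvgr_gt R R (nbhs (phi x)) _ (fun t => `|t|) `|phi x|) => //.
      by apply: cvg_norm; exact: cvg_id.
    move=> /clx[y [Hy /=]]; rewrite ltNge => /negP; apply.
    by rewrite (le_trans (bndphi y))// ler_wpM2l// HM.
  suff [p Fp] : exists p : R, phi @ F --> p by apply/cvg_ex; exists p.
  have := @segment_compact R (- (c * M)) (c * M).
  move=> /(_ (phi @ F) _)[|p [_ clp]].
    suff : F (phi @^-1` `[- (c * M), c * M]) by [].
    by apply: filterS FH => x /clphi; rewrite ler_norml /= in_itv.
  exists p => A pA; have [//|FnA] := in_ultra_setVsetC (phi @^-1` A) FU.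
  by have [y [yA Ay]] := clp _ _ (FnA : (phi @ F) (~` A)) pA.
have LD c c' t phi psi : bounded_functional c phi -> bounded_functional c' psi ->
     L (t *: phi + psi) = t * L phi + L psi.
  move=> /Lcvg cphi /Lcvg cpsi; apply/cvg_lim => //.
  apply: cvgD => //; apply: cvgM; first exact: cvg_cst.
  exact: cphi.
(* An open condition that [F] satisfies eventually holds at some point of the
   weak closure of [H], hence at some point of [H]. *)
have approx (s : seq (E -> R)) (e : R) : 0 < e ->
    (forall phi, phi \in s -> exists c, bounded_functional c phi) ->
    exists2 f, H f & forall phi, phi \in s -> `|L phi - phi f| < e.
  move=> e0 bs.
  have [x [clx xU]] : exists x : weak E, closure (H : set (weak E)) x /\
      forall phi, phi \in s -> `|L phi - phi x| < e.
    apply: (@filter_ex _ F); apply: filterI => //.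
    elim: s bs => [|phi s IH] bs.
      by apply: filterE => x phi.
    have [c bphi] : exists c, bounded_functional c phi by apply: bs; exact: mem_head.
    have h1 := IH (fun psi hpsi => bs psi (@mem_behead _ (phi :: s) psi hpsi)).
    have h2 : F (phi @^-1` [set t | `|L phi - t| < e]).
      by have /cvgrPdist_lt/(_ e e0) := Lcvg _ _ bphi.
    apply: filterS2 h1 h2 => x hs hphi psi; rewrite inE => /predU1P[->//|].
    exact: hs.
  suff : nbhs (x : weak E) [set y | forall phi, phi \in s -> `|L phi - phi y| < e].
    by move=> /clx[y [Hy yU]]; exists y.
  have NF : Filter (nbhs (x : weak E)) by exact: nbhs_filter.
  elim: s bs xU => [|phi s IH] bs xU.
    by apply: filterE => y phi.
  have [c bphi] : exists c, bounded_functional c phi by apply: bs; exact: mem_head.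
  have h1 := IH (fun psi hpsi => bs psi (@mem_behead _ (phi :: s) psi hpsi))
    (fun psi hpsi => xU psi (@mem_behead _ (phi :: s) psi hpsi)).
  have h2 : nbhs x (phi @^-1` [set t | `|L phi - t| < e]).
    apply: (weak_nbhs bphi).
    apply: (@cvgr_lt R R (nbhs (phi x)) _ (fun t => `|L phi - t|) `|L phi - phi x|);
      last by apply: xU; exact: mem_head.
    by apply: cvg_norm; apply: cvgB; [exact: cvg_cst|exact: cvg_id].
  apply: filterS2 h1 h2 => y hs hphi psi; rewrite inE => /predU1P[->//|].
  exact: hs.
have near_eval (r : R) : 0 < r ->
    exists y, forall c phi, bounded_functional c phi -> L phi - phi y <= r * c.
  move=> r0; apply: contrapT => nL.
  pose P phi := bounded_functional 1 phi /\ r < L phi.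
  (* Helly's theorem, normalized to functionals of norm at most one. *)
  have kill (s : seq E) : exists phi, P phi /\ {in s, forall x, phi x = 0}.
    apply: contrapT => nphi; apply: nL; apply: (helly LD (ltW r0) (s := s)).
    move=> c phi bphi phis; rewrite leNgt; apply/negP => Lphi.
    have [c0 lphi bndphi] := bphi.
    have cp : 0 < c.
      rewrite lt_neqAle c0 andbT eq_sym; apply/eqP => cz.
      move: Lphi; rewrite cz mulr0 => Lphi.
      have phi0 : phi = 0.
        apply/funext => x; apply/eqP; rewrite -normr_le0.
        by rewrite (le_trans (bndphi x))// cz mul0r.
      have := LD _ _ (-1) _ _ bphi bphi.
      rewrite scaleN1r addNr => L0; move: Lphi; rewrite phi0 L0; lra.
    apply: nphi; exists (c^-1 *: phi).
    have b0 : bounded_functional 0 (0 : E -> R).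
      by split=> // [a u v|x]; rewrite ?mulr0 ?addr0// mul0r normr0.
    have cZ x : (c^-1 *: phi) x = c^-1 * phi x by [].
    split; last by move=> x xs; rewrite cZ phis// mulr0.
    split.
      split=> //; first by move=> a u v; rewrite /= !cZ lphi; ring.
      move=> x; rewrite cZ normrM gtr0_norm ?invr_gt0// mul1r.
      by rewrite ler_pdivrMl.
    have -> : L (c^-1 *: phi) = c^-1 * L phi.
      apply/cvg_lim => //; apply: cvgM; first exact: cvg_cst.
      exact: Lcvg bphi.
    by rewrite mulrC ltr_pdivlMr.
  pose Q (l : seq ((E -> R) * E)) (a : (E -> R) * E) :=
    (forall p, p \in l -> P p.1) ->
    [/\ P a.1, H a.2, forall p, p \in l -> a.1 p.2 = 0,
      r / 2 < a.1 a.2 & forall p, p \in l -> r / 2 < p.1 a.2].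
  have [l|u Qu] := @history_choice _ Q.
    have [Pl|nPl] := pselect (forall p, p \in l -> P p.1); last first.
      by exists (0, 0) => /nPl.
    have [phi [[bphi Lphi] phil]] := kill (map snd l).
    have [|psi|f Hf fU] := approx (phi :: map fst l) (r / 2).
    - by rewrite divr_gt0.
    - rewrite inE => /predU1P[->|]; first by exists 1.
      by move=> /mapP[p /Pl[? _] ->]; exists 1.
    exists (phi, f) => _ /=; split=> //.
    - by move=> p pl; apply: phil; apply: map_f.
    - by have := fU phi (mem_head _ _); rewrite ltr_norml => /andP[]; lra.
    - move=> p pl; have [_ Lp] := Pl _ pl.
      have := fU p.1 (@mem_behead _ (phi :: map fst l) _ (map_f fst pl)).
      by rewrite ltr_norml => /andP[]; lra.
  have inu n i : (i < n)%N -> u i \in mkseq u n.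
    by move=> ni; apply: map_f; rewrite mem_iota.
  have inu' n p : p \in mkseq u n -> exists2 i, (i < n)%N & p = u i.
    by move=> /mapP[i]; rewrite mem_iota => /= ni ->; exists i.
  have Pu n : P (u n).1.
    elim/ltn_ind: n => n IH.
    by have [p /inu'[i ni ->]|] := Qu n; first exact: IH.
  have Pmk n p : p \in mkseq u n -> P p.1.
    by move=> /inu'[i _ ->]; exact: Pu.
  have Hu n : H (u n).2 by have [] := Qu n (Pmk n).
  have small m i : (i < m)%N -> (u m).1 (u i).2 = 0.
    by move=> im; have [_ _ h _ _] := Qu m (Pmk m); apply: h; exact: inu.
  have big m n : (m <= n)%N -> r / 2 < (u m).1 (u n).2.
    rewrite leq_eqVlt => /predU1P[->|mn]; first by have [] := Qu n (Pmk n).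
    by have [_ _ _ _ h] := Qu n (Pmk n); apply: h; exact: inu.
  have [g gP] := meetH _ Hu.
  (* A combination [h] of finitely many [f_i] is killed by [phi_m] for large [m],
     whereas [phi_m] is at least [r / 2] on the tail from [m] on. *)
  have r8 : 0 < r / 8 by rewrite divr_gt0.
  have close phi (x : E) : P phi -> `|x - g| < r / 8 -> `|phi x - phi g| < r / 8.
    move=> [[_ lphi bphi] _] xg; rewrite -(functionalB lphi).
    by rewrite (le_lt_trans (bphi _))// mul1r.
  have [h hh hg] := gP 0%N _ r8.
  have [N hN] : exists N, forall m, (N <= m)%N -> (u m).1 h = 0.
    apply: (tail_hull_mem
      (C := [set h | exists N, forall m, (N <= m)%N -> (u m).1 h = 0]) hh) => [x y t [N xN] [N' yN] t0 t1|k _].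
      exists (maxn N N') => m; rewrite geq_max => /andP[Nm N'm].
      have [[_ lphi _] _] := Pu m.
      by rewrite (functionalD lphi) !(functionalZ lphi) ?xN ?yN// !mulr0 addr0.
    by exists k.+1 => m km; exact: small.
  have [h' hh' hg'] := gP N _ r8.
  have h'N : r / 2 <= (u N).1 h'.
    have [[_ lphi _] _] := Pu N.
    apply: (tail_hull_mem (C := [set h | r / 2 <= (u N).1 h]) hh') => [x y t rx ry t0 t1|k /big/ltW//].
    rewrite /= (functionalD lphi) !(functionalZ lphi).
    have -> : r / 2 = t * (r / 2) + (1 - t) * (r / 2) by ring.
    by rewrite lerD// ler_wpM2l// subr_ge0.
  have := close _ _ (Pu N) hg; have := close _ _ (Pu N) hg'.
  rewrite hN// !ltr_norml => /andP[h1 h2] /andP[h3 h4].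
  lra.
have /choice[y yP] : forall n : nat, exists y, forall c phi,
    bounded_functional c phi -> L phi - phi y <= 2 ^- n.+2 * c.
  by move=> n; apply: near_eval; rewrite invr_gt0 exprn_gt0.
have yN n c phi : bounded_functional c phi -> `|L phi - phi (y n)| <= 2 ^- n.+2 * c.
  move=> bphi; have [c0 lphi bndphi] := bphi.
  rewrite ler_norml (yP _ _ _ bphi) andbT.
  have b0 : bounded_functional 0 (0 : E -> R).
    by split=> // [a u v|x]; rewrite ?mulr0 ?addr0// mul0r normr0.
  have bN : bounded_functional c (- phi).
    split=> //; first by move=> a u v /=; rewrite !fctE lphi; ring.
    by move=> x; rewrite fctE normrN.
  have LN : L (- phi) = - L phi.
    have L0 := LD _ _ (-1) _ _ b0 b0.
    have := LD _ _ (-1) _ _ bphi b0.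
    rewrite scaleN1r !addr0 => ->.
    by move: L0; rewrite scaler0 addr0; lra.
  by have := yP n _ _ bN; rewrite LN fctE; lra.
have /cvg_ex[x yx] : cvgn y.
  apply: complE => n; have [phi bphi <-] := exists_norming (y n.+1 - y n).
  have [_ lphi _] := bphi; rewrite (functionalB lphi).
  have := yN n _ _ bphi; have := yN n.+1 _ _ bphi.
  rewrite !mulr1 !ler_norml => /andP[h1 h2] /andP[h3 h4].
  have e1 : 2 ^- n.+3 <= 2 ^- n.+2 :> R.
    by rewrite lef_pV2 ?posrE ?exprn_gt0// ler_eXn2l// ltr1n.
  have e2 : 2 ^- n = 4 * 2 ^- n.+2 :> R.
    by rewrite !exprS; field; rewrite expf_neq0.
  have e3 : 0 < 2 ^- n.+2 :> R by rewrite invr_gt0 exprn_gt0.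
  lra.
have xL c phi : bounded_functional c phi -> L phi = phi x.
  move=> bphi; have [c0 lphi bndphi] := bphi.
  apply/eqP; rewrite -subr_eq0 -normr_le0; apply/ler_addgt0Pr => e e0.
  rewrite add0r.
  pose d := e / 2 / (c + 1).
  have c1 : 0 < c + 1 by rewrite ltr_wpDl.
  have d0 : 0 < d by rewrite !divr_gt0.
  have [n [h1 h2]] : exists n, `|x - y n| < d /\ 2 ^- n.+2 < d.
    apply: (@filter_ex _ \oo); near=> n; split.
      by near: n; move/cvgrPdist_lt: yx; apply.
    apply: (@le_lt_trans _ _ (1 / 2 ^+ n)).
      by rewrite div1r lef_pV2 ?posrE ?exprn_gt0// ler_eXn2l ?ltr1n// !leqW.
    by near: n; apply: (near_infty_natSinv_expn_lt (PosNum d0)).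
  have := yN n _ _ bphi; have := bndphi (y n - x).
  rewrite (functionalB lphi) (distrC (y n)) => h3 h4.
  rewrite -[L phi](subrK (phi (y n))) -addrA.
  apply: (le_trans (ler_normD _ _)); apply: (le_trans (lerD h4 h3)).
  rewrite mulrC -mulrDr.
  apply: (@le_trans _ _ (c * (d + d))); first by rewrite ler_wpM2l// lerD// ltW.
  have -> : e = (c + 1) * (d + d) by rewrite /d; field; rewrite gt_eqF.
  by rewrite ler_wpM2r ?lerDl// addr_ge0// ltW.
have Fx : F --> (x : weak E).
  apply/weak_cvgP => phi; have [c bphi] := dual_bounded phi.
  by rewrite -(xL _ _ bphi); exact: Lcvg bphi.
exists x; split=> //.
exact: (@closed_cvg _ _ F FF id _ (@closed_closure _ _) FH _ Fx).
Unshelve. all: by end_near. Qed.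

End tail_hulls_meet_precompact.

(** * Integrals over small sets *)

Section small_sets.
Context d (T : measurableType d) (R : realType).
Variable mu : {measure set T -> \bar R}.
Implicit Types (F w : T -> R) (B : set T).

Lemma integral_vanishing_sets F (E : nat -> set T) :
  mu.-integrable setT (EFin \o F) -> (forall t, 0 <= F t) ->
  (forall k, measurable (E k)) ->
  {ae mu, forall t, \forall k \near \oo, ~ E k t} ->
  (\int[mu]_(t in E k) (F t)%:E @[k --> \oo] --> 0)%E.
Proof.
move=> iF F0 mE Et.
have mF : measurable_fun setT F by apply/measurable_EFinP; exact: measurable_int iF.
have m1 n : measurable_fun setT (EFin \o (fun t => F t * \1_(E n) t)).
  apply/measurable_EFinP; apply: measurable_funM => //.
have c1 : {ae mu, forall t, setT t ->
    (EFin \o (fun t => F t * \1_(E n) t)) t @[n --> \oo] --> 0%E}.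
  apply: filterS Et => t Et _; apply: cvg_near_cst; apply: filterS Et => k Et.
  by rewrite /= indicE memNset// mulr0.
have [_ _] := dominated_convergence measurableT m1 (measurable_cst 0%E) c1
  iF ltac:(by apply: aeW => t n _;
    rewrite /= lee_fin ger0_norm ?mulr_ge0// ler_piMr// indicE; case: (_ \in _)).
rewrite integral0.
suff -> : [sequence (\int[mu]_x (EFin \o (fun t => F t * \1_(E n) t)%R) x)%E]_n =
  (fun k => \int[mu]_(t in E k) (F t)%:E)%E by [].
apply/funext => k; rewrite [RHS]integral_mkcond.
by rewrite epatch_indic; apply: eq_integral => t _ /=; rewrite EFinM.
Qed.

(** Absolute continuity with respect to the density [w]: outside of the sets
    where [F] exceeds a large multiple of [w], which carry a small part of the
    integral, it is dominated by this multiple. *)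
Lemma weighted_absolute_continuity F w :
  mu.-integrable setT (EFin \o F) -> (forall t, 0 <= F t) ->
  measurable_fun setT w -> (forall t, 0 < w t) ->
  forall e : R, 0 < e -> exists2 delta : R, 0 < delta &
  forall B, measurable B -> (\int[mu]_(t in B) (w t)%:E < delta%:E)%E ->
    (\int[mu]_(t in B) (F t)%:E < e%:E)%E.
Proof.
move=> iF F0 mw w0 e e0.
have mF : measurable_fun setT F by apply/measurable_EFinP; exact: measurable_int iF.
pose E (k : nat) := [set t | k%:R * w t < F t].
have mE k : measurable (E k).
  rewrite -[E k]setTI; apply: (measurable_fun_ltr (f := fun t => k%:R * w t)) => //.
  by apply: measurable_funM => //; exact: measurable_cst.
have Et t : \forall k \near \oo, ~ E k t.
  exists (Num.bound (F t / w t)) => // k /= Nk; apply/negP; rewrite -leNgt.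
  rewrite -ler_pdivrMr//.
  have /archi_boundP/ltW/le_trans : 0 <= F t / w t by rewrite divr_ge0// ltW.
  by apply; rewrite ler_nat.
have /= := integral_vanishing_sets iF F0 mE (aeW _ Et).
have e20 : 0 < e / 2 by rewrite divr_gt0.
move=> /fine_cvgP[fin cvg0].
have [k [finE Ek]] : exists k, (\int[mu]_(t in E k) (F t)%:E)%E \is a fin_num /\
    (\int[mu]_(t in E k) (F t)%:E < (e / 2)%:E)%E.
  apply: (@filter_ex _ \oo); apply: filterS2 fin (cvgr_lt _ cvg0 _ e20).
  by move=> k fk; rewrite -lte_fin fineK.
exists (e / 2 / k.+1%:R); first by rewrite divr_gt0.
move=> B mB wB.
have mFB D : measurable_fun D (EFin \o F).
  by apply: measurable_funTS; exact/measurable_EFinP.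
have mwB D : measurable_fun D (EFin \o w).
  by apply: measurable_funTS; exact/measurable_EFinP.
have mBE : measurable (B `\` E k) by exact: measurableD.
have mBE' : measurable (B `&` E k) by exact: measurableI.
rewrite -(setUIDK B (E k)) ge0_integral_setU//; last 2 first.
- by move=> t _; rewrite lee_fin.
- by apply/disj_setPS => t [[_ Et'] [_]].
have -> : e%:E = ((e / 2)%:E + (e / 2)%:E)%E by rewrite -EFinD -splitr.
apply: lteD.
  apply: le_lt_trans Ek; apply: ge0_subset_integral => //.
  by move=> t _; rewrite lee_fin.
apply: (@le_lt_trans _ _ (\int[mu]_(t in B `\` E k) (k.+1%:R%:E * (w t)%:E))%E).
  apply: ge0_le_integral => //.
  - by move=> t _; rewrite lee_fin.
  - by apply: emeasurable_funM => //; exact: measurable_cst.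
  move=> t [_ /negP]; rewrite -leNgt => h; rewrite lee_fin (le_trans h)//.
  by rewrite ler_pM2r// ler_nat.
rewrite ge0_integralZl//; last first.
  by move=> t _; rewrite lee_fin ltW.
rewrite -lte_pdivlMl// -EFinM mulrC; apply: le_lt_trans wB.
apply: ge0_subset_integral => //.
by move=> t _; rewrite lee_fin ltW.
Qed.

End small_sets.

(** * Bochner integrable functions *)

Section L1_basics.
Context d (T : measurableType d) (R : realType) (X : normedModType R).
Variable mu : {measure set T -> \bar R}.
Local Notation L1 := (L1 X mu).
Local Notation SM := (strongly_measurable mu).
Implicit Types (f g : T -> X) (B : set T).

(** A strongly measurable function is measurable only up to a null set, so that
    its norm has to be replaced by a measurable version. *)
Definition mnorm f : T -> R := xget (fun=> 0)
  [set F : T -> R | [/\ measurable_fun setT F, forall t, 0 <= F t &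
    {ae mu, forall t, `|f t| = F t}]].

Lemma mnormP f : SM f -> [/\ measurable_fun setT (mnorm f),
  forall t, 0 <= mnorm f t & {ae mu, forall t, `|f t| = mnorm f t}].
Proof. by move=> /strongly_measurable_norm; exact: xgetPex. Qed.

Lemma mnorm_ge0 f t : 0 <= mnorm f t.
Proof. by rewrite /mnorm; case: xgetP => [F -> []|]. Qed.

Lemma measurable_mnorm f : measurable_fun setT (mnorm f).
Proof. by rewrite /mnorm; case: xgetP => [F -> []//|_]; exact: measurable_cst. Qed.

Lemma measurable_mnormE f : measurable_fun setT (EFin \o mnorm f).
Proof. by apply/measurable_EFinP; exact: measurable_mnorm. Qed.

Lemma integral_norm_ae f (F : T -> R) B :
  {ae mu, forall t, `|f t| = F t} ->
  (\int[mu]_(t in B) `|f t|%:E = \int[mu]_(t in B) `|F t|%:E)%E.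
Proof.
move=> fF; rewrite integral_mkcond [RHS]integral_mkcond.
apply: ge0_integral_ae_ext => [t|t|].
- by rewrite /patch; case: ifP => // _; rewrite lee_fin.
- by rewrite /patch; case: ifP => // _; rewrite lee_fin.
by apply: filterS fF => t ft; rewrite /patch -ft normr_id.
Qed.

Lemma integral_mnorm f B : SM f ->
  (\int[mu]_(t in B) `|f t|%:E = \int[mu]_(t in B) (mnorm f t)%:E)%E.
Proof.
move=> /mnormP[_ _ fF]; rewrite (integral_norm_ae _ fF).
by apply: eq_integral => t _; rewrite ger0_norm// mnorm_ge0.
Qed.

Lemma strongly_measurableZfun f (h : T -> R) :
  SM f -> simple_function h -> SM (fun t => h t *: f t).
Proof.
move=> [s [ss sf]] sh; exists (fun n t => h t *: s n t); split=> [n|].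
  exact: (simple_op2 (fun a x => a *: x) sh (ss n)).
by apply: filterS sf => t; exact: cvgZr.
Qed.

Lemma simple_indic B : measurable B -> simple_function (\1_B : T -> R).
Proof.
move=> mB; split.
  apply: (sub_finite_set _ (finite_set2 (0 : R) 1)) => _ [t _ <-] /=.
  by rewrite indicE; case: (_ \in _); [right|left].
by move=> x; rewrite -[X in measurable X]setTI; exact: (measurable_indic mB).
Qed.

Definition mkL1 f : L1 := if pselect (bochner_integrable mu f) is left h
  then \pi_(Defs.L1 X mu)%qT (BochnerFun (mem_set h)) else 0.

Lemma mkL1E f : bochner_integrable mu f -> {ae mu, forall t, mkL1 f t = f t}.
Proof.
by rewrite /mkL1; case: pselect => // h _; exact: (L1_piE (BochnerFun (mem_set h))).
Qed.

Lemma L1_norm_ae (u : L1) (F : T -> R) : {ae mu, forall t, `|u t| = F t} ->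
  (`|u|%:E = \int[mu]_t `|F t|%:E)%E.
Proof. by move=> uF; rewrite L1_normE (integral_norm_ae _ uF). Qed.

Lemma L1_norm_mnorm (u : L1) : (`|u|%:E = \int[mu]_t (mnorm u t)%:E)%E.
Proof. by rewrite L1_normE integral_mnorm//; exact: (L1_integrable u).1. Qed.

Lemma integrable_mnorm (u : L1) : mu.-integrable setT (EFin \o mnorm u).
Proof.
apply/integrableP; split; first exact: measurable_mnormE.
under eq_integral do rewrite /= ger0_norm ?mnorm_ge0//.
by rewrite -L1_norm_mnorm ltry.
Qed.

Lemma L1_subE (u v : L1) : {ae mu, forall t, (u - v : L1) t = u t - v t}.
Proof.
have := L1_addE u (- v); have := L1_scaleE (-1) v.
rewrite scaleN1r; apply: filterS2 => t h1 h2.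
by rewrite h2 h1 scaleN1r.
Qed.

Lemma L1_0E : {ae mu, forall t, (0 : L1) t = 0}.
Proof.
by have := L1_scaleE 0 (0 : L1); rewrite scale0r; apply: filterS => t ->; rewrite scale0r.
Qed.

Lemma L1_sumE (I : Type) (r : seq I) (u : I -> L1) :
  {ae mu, forall t, (\sum_(i <- r) u i : L1) t = \sum_(i <- r) u i t}.
Proof.
elim: r => [|i r IH].
  by rewrite big_nil; apply: filterS L1_0E => t ->; rewrite big_nil.
rewrite big_cons; apply: filterS2 IH (L1_addE (u i) (\sum_(i <- r) u i : L1)).
by move=> t h1 h2; rewrite h2 h1 big_cons.
Qed.

End L1_basics.

(** * Restriction to a measurable set *)

HB.lock Definition restr d (T : measurableType d) (R : realType)
    (X : normedModType R) (mu : {measure set T -> \bar R}) (B : set T)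
    (u : L1 X mu) : L1 X mu :=
  mkL1 mu (fun t => (\1_B t : R) *: u t).

(** The integral of the norm of [u] over [B], see [massE]. *)
HB.lock Definition mass d (T : measurableType d) (R : realType)
    (X : normedModType R) (mu : {measure set T -> \bar R}) (B : set T)
    (u : L1 X mu) : R :=
  `|restr B u|.

Section restriction.
Context d (T : measurableType d) (R : realType) (X : normedModType R).
Variable mu : {measure set T -> \bar R}.
Local Notation L1 := (L1 X mu).
Implicit Types (u v : L1) (A B : set T).

Lemma bochner_integrable_restr B (u : L1) : measurable B ->
  bochner_integrable mu (fun t => (\1_B t : R) *: u t).
Proof.
move=> mB; have [mu1 mu2] := L1_integrable u; split.
  by apply: strongly_measurableZfun => //; exact: simple_indic.
have [F [mF F0 uF]] := strongly_measurable_norm mu1.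
have [G [mG G0 buG]] :=
  strongly_measurable_norm (strongly_measurableZfun mu1 (simple_indic R mB)).
apply: le_lt_trans mu2.
rewrite (integral_norm_ae _ uF) (integral_norm_ae _ buG).
apply: ae_ge0_le_integral => //.
- by apply/measurable_EFinP; exact: measurableT_comp.
- by apply/measurable_EFinP; exact: measurableT_comp.
apply: filterS2 uF buG => t ht hbt _.
rewrite -ht -hbt !normr_id lee_fin normrZ ler_piMl// indicE.
by case: (_ \in _); rewrite ?normr1 ?normr0.
Qed.

Lemma restrE B (u : L1) : measurable B ->
  {ae mu, forall t, restr B u t = (\1_B t : R) *: u t}.
Proof. by move=> mB; rewrite unlock; apply: mkL1E; exact: bochner_integrable_restr. Qed.

Lemma norm_restr B u : `|restr B u| = mass B u.
Proof. by rewrite [mass]unlock. Qed.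

Lemma mass_ge0 B u : 0 <= mass B u.
Proof. by rewrite -norm_restr. Qed.

Lemma massE B u : measurable B -> ((mass B u)%:E = \int[mu]_(t in B) `|u t|%:E)%E.
Proof.
move=> mB; rewrite -norm_restr.
have : {ae mu, forall t, `|restr B u t| = `|(\1_B t : R) *: u t|}.
  by apply: filterS (restrE u mB) => t ->.
move=> /L1_norm_ae ->; rewrite [RHS]integral_mkcond; apply: eq_integral => t _.
rewrite /patch indicE normr_id normrZ; case: ifP => _.
  by rewrite normr1 mul1r.
by rewrite normr0 mul0r.
Qed.

Lemma mass_mnorm B u : measurable B ->
  ((mass B u)%:E = \int[mu]_(t in B) (mnorm mu u t)%:E)%E.
Proof.
by move=> mB; rewrite massE// integral_mnorm//; exact: (L1_integrable u).1.
Qed.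

Lemma restr_linear B (a : R) (u v : L1) : measurable B ->
  restr B (a *: u + v) = a *: restr B u + restr B v.
Proof.
move=> mB; apply/L1_eqP.
near=> t.
rewrite (near (restrE (a *: u + v) mB) t)//.
rewrite (near (L1_addE (a *: u) v) t)// (near (L1_scaleE a u) t)//.
rewrite (near (L1_addE (a *: restr B u) (restr B v)) t)//.
rewrite (near (L1_scaleE a (restr B u)) t)//.
rewrite (near (restrE u mB) t)// (near (restrE v mB) t)//.
by rewrite scalerDr !scalerA mulrC.
Unshelve. all: by end_near. Qed.

Lemma restrD B (u v : L1) : measurable B -> restr B (u + v) = restr B u + restr B v.
Proof. by move=> mB; have := restr_linear 1 u v mB; rewrite !scale1r. Qed.

Lemma restr0 B : measurable B -> restr B (0 : L1) = 0.
Proof.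
by move=> mB; have := restr_linear (-1) 0 0 mB; rewrite !scaleN1r !addNr.
Qed.

Lemma restrZ B a (u : L1) : measurable B -> restr B (a *: u) = a *: restr B u.
Proof. by move=> mB; have := restr_linear a u 0 mB; rewrite restr0// !addr0. Qed.

Lemma restrB B (u v : L1) : measurable B -> restr B (u - v) = restr B u - restr B v.
Proof. by move=> mB; rewrite restrD// -scaleN1r restrZ// scaleN1r. Qed.

Lemma restr_sum B (I : Type) (r : seq I) (u : I -> L1) : measurable B ->
  restr B (\sum_(i <- r) u i) = \sum_(i <- r) restr B (u i).
Proof.
move=> mB; elim: r => [|i r IH]; first by rewrite !big_nil restr0.
by rewrite !big_cons restrD// IH.
Qed.

Lemma restrT (u : L1) : restr setT u = u.
Proof.
by apply/L1_eqP; apply: filterS (restrE u measurableT) => t ->; rewrite indicT scale1r.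
Qed.

Lemma restrU A B (u : L1) : measurable A -> measurable B -> A `&` B = set0 ->
  restr (A `|` B) u = restr A u + restr B u.
Proof.
move=> mA mB AB; apply/L1_eqP; near=> t.
rewrite (near (restrE u (measurableU _ _ mA mB)) t)//.
rewrite (near (L1_addE (restr A u) (restr B u)) t)//.
rewrite (near (restrE u mA) t)// (near (restrE u mB) t)// -scalerDl.
congr (_ *: _); rewrite !indicE in_setU.
case: (boolP (t \in A)) => tA; case: (boolP (t \in B)) => tB; rewrite ?addr0 ?add0r//.
by move: AB => /seteqP[/(_ t)]; rewrite !inE in tA tB *; case.
Unshelve. all: by end_near. Qed.

Lemma massT u : mass setT u = `|u|.
Proof. by rewrite -norm_restr restrT. Qed.

Lemma massD B u v : measurable B -> mass B (u + v) <= mass B u + mass B v.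
Proof. by move=> mB; rewrite -!norm_restr restrD//; exact: ler_normD. Qed.

Lemma massZ B (a : R) u : measurable B -> mass B (a *: u) = `|a| * mass B u.
Proof. by move=> mB; rewrite -!norm_restr restrZ// normrZ. Qed.

Lemma massN B u : measurable B -> mass B (- u) = mass B u.
Proof. by move=> mB; rewrite -scaleN1r massZ// normrN1 mul1r. Qed.

Lemma le_mass A B u : measurable A -> measurable B -> A `<=` B ->
  mass A u <= mass B u.
Proof.
move=> mA mB AB; rewrite -lee_fin !mass_mnorm//.
apply: ge0_subset_integral => //.
  by apply: measurable_funTS; exact: measurable_mnormE.
by move=> t _; rewrite lee_fin mnorm_ge0.
Qed.

Lemma mass_le_norm B u : measurable B -> mass B u <= `|u|.
Proof. by move=> mB; rewrite -massT le_mass. Qed.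

Lemma massB_le B u v : measurable B -> mass B u <= mass B v + `|u - v|.
Proof.
move=> mB; have := massD v (u - v) mB; rewrite [v + _]addrC subrK => h.
by apply: (le_trans h); rewrite lerD2l mass_le_norm.
Qed.

Lemma massU A B u : measurable A -> measurable B -> A `&` B = set0 ->
  mass (A `|` B) u = mass A u + mass B u.
Proof.
move=> mA mB AB; apply: EFin_inj; rewrite EFinD !mass_mnorm//; last first.
  exact: measurableU.
rewrite ge0_integral_setU//.
- by apply: measurable_funTS; exact: measurable_mnormE.
- by move=> t _; rewrite lee_fin mnorm_ge0.
- by apply/disj_setPS; rewrite AB.
Qed.

Lemma massU_le A B u : measurable A -> measurable B ->
  mass (A `|` B) u <= mass A u + mass B u.
Proof.
move=> mA mB; have mBA : measurable (B `\` A) by exact: measurableD.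
have -> : A `|` B = A `|` (B `\` A).
  by rewrite setDE setUIr setUv setIT.
rewrite massU//; first by rewrite lerD2l le_mass.
by rewrite setIDA setIC -setIDA setDv setI0.
Qed.

Lemma mass_set0 u : mass set0 u = 0.
Proof. by apply: EFin_inj; rewrite massE// integral_set0. Qed.

Lemma mass_trivIset n (E : nat -> set T) (F : set T) u :
  (forall k, measurable (E k)) -> measurable F -> trivIset setT E ->
  (forall k, E k `<=` F) ->
  \sum_(k < n) mass (E k) u <= mass F u.
Proof.
move=> mE mF tE EF.
suff -> : \sum_(k < n) mass (E k) u = mass (\bigcup_(k < n) E k) u.
  apply: le_mass => //; first by apply: bigcup_measurable => k _.
  by move=> t [k _ /EF].
elim: n => [|n IH].
  by rewrite big_ord0 bigcup_mkord big_ord0 mass_set0.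
rewrite big_ord_recr/= IH [in RHS]bigcup_mkord big_ord_recr/= -bigcup_mkord massU//.
  by apply: bigcup_measurable => k _.
rewrite setI_bigcupl; apply: bigcup0 => k /= kn.
apply/eqP/negPn/negP => /set0P[t [Ekt Ent]].
have := tE k n I I (ex_intro _ t (conj Ekt Ent)).
by move=> kE; rewrite kE ltnn in kn.
Qed.

Lemma mass_cvg0 (E : nat -> set T) u : (forall k, measurable (E k)) ->
  {ae mu, forall t, \forall k \near \oo, ~ E k t} ->
  mass (E k) u @[k --> \oo] --> 0.
Proof.
move=> mE Et.
have := integral_vanishing_sets (integrable_mnorm u)
  (fun t => mnorm_ge0 mu u t) mE Et.
have -> : (fun k => \int[mu]_(t in E k) (mnorm mu u t)%:E)%E =
  (EFin \o (fun k => mass (E k) u)).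
  by apply/funext => k; rewrite /= mass_mnorm.
by move/fine_cvgP => [_].
Qed.

End restriction.

(** * Equi-integrability through a finite equivalent measure *)

Section weight.
Context d (T : measurableType d) (R : realType).
Variable mu : {measure set T -> \bar R}.
Implicit Types (w : T -> R) (B : set T).

Lemma integral_bigcup_le w (E : nat -> set T) (delta : R) :
  measurable_fun setT w -> (forall t, 0 <= w t) ->
  (forall n, measurable (E n)) -> 0 <= delta ->
  (forall n, \int[mu]_(t in E n) (w t)%:E <= (delta / (2 ^ n.+1)%:R)%:E)%E ->
  (\int[mu]_(t in \bigcup_n E n) (w t)%:E <= delta%:E)%E.
Proof.
move=> mw w0 mE d0 Ed.
apply: le_trans (epsilon_trick0 xpredT d0).
apply: (@le_trans _ _ (\sum_(n <oo) \int[mu]_(t in E n) (w t)%:E)%E); last first.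
  apply: lee_nneseries => [n _ _|n _]; last exact: Ed.
  by apply: integral_ge0 => t _; rewrite lee_fin.
have mf n : measurable_fun setT ((fun t => (w t)%:E) \_ (E n)).
  apply/measurable_restrict => //; apply: measurable_funTS.
  exact/measurable_EFinP.
have f0 n t : (0 <= ((fun t => (w t)%:E) \_ (E n)) t)%E.
  by rewrite /patch; case: ifP => // _; rewrite lee_fin.
under eq_eseriesr do rewrite integral_mkcond.
rewrite -integral_nneseries//.
have mU : measurable (\bigcup_n E n) by exact: bigcupT_measurable.
rewrite integral_mkcond; apply: ge0_le_integral => //.
- by move=> t _; rewrite /patch; case: ifP => // _; rewrite lee_fin.
- apply/measurable_restrict => //; apply: measurable_funTS.
  exact/measurable_EFinP.
- by apply: ge0_emeasurable_sum => // n t _ _; exact: f0.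
move=> t _; rewrite {1}/patch; case: ifPn => [|_].
  rewrite inE => -[n _ Ent].
  apply: le_trans (nneseries_lim_ge n.+1 _) => //.
  rewrite big_nat_recr//= [X in (_ <= _ + X)%E]/patch mem_set//.
  by rewrite leeDr// sume_ge0.
exact: nneseries_ge0.
Qed.

(** The density of a finite measure that has the same null sets as [mu] and
    is smaller than [mu]. *)
Definition weight w := [/\ measurable_fun setT w, forall t, 0 < w t,
  forall t, w t <= 1 & mu.-integrable setT (EFin \o w)].

End weight.

(** The coefficients [c n] make the sum of the indicators of a countable cover
    by sets of finite measure bounded by [1] and integrable. *)
Lemma exists_weight d (T : measurableType d) (R : realType)
  (mu : {sigma_finite_measure set T -> \bar R}) : exists w, weight mu w.
Proof.
have [F FT mF] := sigma_finiteT mu.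
pose m n := fine (mu (F n)).
have m0 n : 0 <= m n by rewrite fine_ge0.
have mE n : mu (F n) = (m n)%:E by rewrite fineK// ge0_fin_numE// (mF n).2.
pose c n : R := 1 / (2 ^ n.+1)%:R / (1 + m n).
have c0 n : 0 < c n by rewrite !divr_gt0// ltr_pwDl.
pose h n t : \bar R := (c n * \1_(F n) t)%:E.
have h0 n t : (0 <= h n t)%E by rewrite lee_fin mulr_ge0// ltW.
have mh n : measurable_fun setT (h n).
  apply/measurable_EFinP; apply: measurable_funM; first exact: measurable_cst.
  by apply: measurable_indic; exact: (mF n).1.
pose W t := (\sum_(n <oo) h n t)%E.
have mW : measurable_fun setT W by exact: ge0_emeasurable_sum.
have W1 t : (W t <= 1%:E)%E.
  apply: le_trans (epsilon_trick0 xpredT ler01).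
  apply: lee_nneseries => [n _ _|n _]; first exact: h0.
  rewrite lee_fin /c -[leLHS]mulrA ler_piMr ?divr_ge0//.
  rewrite indicE ler_pdivrMl ?ltr_pwDl// mulr1.
  by case: (_ \in _); rewrite ?lerDl// addr_ge0.
have W0 t : (0 < W t)%E.
  have : [set: T] t by [].
  rewrite FT => -[n _ Fnt].
  apply: lt_le_trans (nneseries_lim_ge n.+1 _); last by move=> k _ _; exact: h0.
  rewrite big_nat_recr//=; apply: (@lt_le_trans _ _ (h n t)).
    by rewrite /h indicE mem_set// mulr1 lte_fin.
  by rewrite leeDr// sume_ge0.
have Wfin t : W t \is a fin_num.
  by rewrite ge0_fin_numE ?ltW// (le_lt_trans (W1 t))// ltry.
have wW : EFin \o (fun t => fine (W t)) = W.
  by apply/funext => t /=; rewrite fineK.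
exists (fun t => fine (W t)); split.
- by apply/measurable_EFinP; rewrite wW.
- by move=> t; rewrite fine_gt0// W0 (le_lt_trans (W1 t))// ltry.
- by move=> t; rewrite -lee_fin fineK.
rewrite wW; apply/integrableP; split=> //.
under eq_integral do rewrite gee0_abs ?ltW//.
rewrite integral_nneseries//.
apply: le_lt_trans (ltry 1); apply: le_trans (epsilon_trick0 xpredT ler01).
apply: lee_nneseries => [n _ _|n _]; first exact: integral_ge0.
rewrite (_ : (fun t => h n t) = (fun t => (c n)%:E * (\1_(F n) t)%:E)%E)//.
rewrite ge0_integralZl//; last 2 first.
- by apply/measurable_EFinP; apply: measurable_indic; exact: (mF n).1.
- by rewrite lee_fin ltW.
rewrite integral_indic ?setIT//; last exact: (mF n).1.
rewrite [X in (_ * X)%E](_ : _ = (m n)%:E); last exact: mE.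
rewrite -EFinM lee_fin /c -[leLHS]mulrA ler_piMr ?divr_ge0//.
by rewrite mulrC ler_pdivrMr ?ltr_pwDl// mul1r lerDr.
Qed.

Section weighted_uniform_integrability.
Context d (T : measurableType d) (R : realType) (X : normedModType R).
Variables (mu : {sigma_finite_measure set T -> \bar R}).
Implicit Types (w : T -> R) (B : set T) (H : set (L1 X mu)).

(** Uniform integrability with respect to the measure of density [w]. As this
    measure is finite, the condition also makes the tails along a coverage
    uniformly small. *)
Definition weighted_ui w H := forall e : R, 0 < e -> exists2 delta : R, 0 < delta &
  forall u, H u -> forall B, measurable B ->
  (\int[mu]_(t in B) (w t)%:E < delta%:E)%E -> mass B u < e.

Lemma mass_weight w (u : L1 X mu) : weight mu w -> weighted_ui w [set u].
Proof.
move=> [mw w0 _ _] e e0.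
have [delta d0 h] := weighted_absolute_continuity (integrable_mnorm u)
  (mnorm_ge0 mu u) mw w0 e0.
by exists delta => // _ -> B mB /(h _ mB); rewrite -lte_fin mass_mnorm.
Qed.

Lemma increasing_cover : exists A : (set T)^nat, [/\ A 0%N = set0,
  forall n, measurable (A n) /\ (mu (A n) < +oo)%E,
  forall n, A n `<=` A n.+1 & \bigcup_n A n = setT].
Proof.
have [F FT mF] := sigma_finiteT mu.
exists (fun n => \bigcup_(i < n) F i); split.
- by rewrite bigcup_mkord big_ord0.
- have mU n : measurable (\bigcup_(i < n) F i).
    by apply: bigcup_measurable => k _; exact: (mF k).1.
  move=> n; split=> //; elim: n => [|n IH].
    by rewrite bigcup_mkord big_ord0 measure0 ltry.
  rewrite bigcup_mkord big_ord_recr/= -bigcup_mkord.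
  apply: le_lt_trans (measureU2 mu (mU n) (mF n).1) _.
  by apply: lte_add_pinfty => //; exact: (mF n).2.
- by move=> n t [k /= kn Fkt]; exists k => //=; exact: ltnW.
- apply/seteqP; split=> // t _; have : [set: T] t by [].
  by rewrite FT => -[n _ Fnt]; exists n.+1 => //; exists n => /=.
Qed.

(** The complements of an increasing cover have integrals of [w] tending to
    zero, so that along a subsequence [L] of the cover the tails decrease
    geometrically. *)
Lemma weighted_ui_equi_integrable w H (M : R) : weight mu w ->
  (forall u, H u -> `|u| <= M) -> weighted_ui w H -> equi_integrable H.
Proof.
move=> [mw w0 w1 iw] HM uiH.
have [A [A0 mA AS AT]] := increasing_cover.
have Amono n m : (n <= m)%N -> A n `<=` A m.
  elim: m => [|m IH]; first by rewrite leqn0 => /eqP ->.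
  by rewrite leq_eqVlt => /predU1P[->//|/IH]; move=> /subset_trans; exact.
have mAC n : measurable (~` A n) by apply: measurableC; exact: (mA n).1.
have AC t : \forall n \near \oo, ~ (~` A n) t.
  have : [set: T] t by [].
  rewrite -AT => -[N _ ANt]; exists N => // n /= Nn; apply.
  exact: Amono Nn _ ANt.
have /fine_cvgP[fin cvg0] := integral_vanishing_sets iw (fun t => ltW (w0 t)) mAC
  (aeW _ AC).
have /choice[N NP] : forall k : nat, exists N, forall u, H u -> forall n, (N <= n)%N ->
    mass (~` A n) u <= 2 ^- k.
  move=> k; have [|delta d0 dP] := uiH (2 ^- k); first by rewrite invr_gt0 exprn_gt0.
  have [n0 _ h] : \forall n \near \oo,
      (\int[mu]_(t in ~` A n) (w t)%:E < delta%:E)%E.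
    apply: filterS2 fin (cvgr_lt _ cvg0 _ d0) => n fn.
    by rewrite -lte_fin /= fineK.
  exists n0 => u Hu n n0n; apply/ltW/dP => //.
  exact: h.
pose L k := (\sum_(i < k.+1) (N i).+1)%N.
have LN k : (N k <= L k)%N.
  by rewrite /L big_ord_recr/= (leq_trans (leqnSn _))// leq_addl.
have Lk k : (k <= L k)%N.
  elim: k => // k IH; rewrite /L big_ord_recr/= addnS ltnS.
  exact: leq_trans IH (leq_addr _ _).
have LS k : (L k <= L k.+1)%N by rewrite /L [leqRHS]big_ord_recr/= leq_addr.
(* The summand [4] serves the tails, which start with index 2; the first
   difference is only bounded by [M]. *)
pose C : R := 2 * `|M| + 4.
have C0 : 0 <= C by rewrite addr_ge0// mulr_ge0.
exists (fun n => if n is k.+1 then A (L k) else set0); split; [split|split].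
- by [].
- by case=> [|k]; [split; rewrite ?measure0//; exact: ltry|exact: mA].
- by case=> [//|k]; apply: Amono.
- apply/seteqP; split=> // t _; have [N0 _ h] := AC t.
  exists N0.+1 => //; apply: contrapT => nA.
  exact: (h (L N0) (Lk N0)).
- move=> e e0; have [delta d0 dP] := uiH _ e0; exists delta => // u Hu B mB muB.
  rewrite -massE// lte_fin; apply: dP => //; apply: le_lt_trans muB.
  rewrite -[leRHS]mul1e -integral_cst//; apply: ge0_le_integral => //.
  + by move=> t _; rewrite lee_fin ltW.
  + by apply: measurable_funTS; exact/measurable_EFinP.
  by move=> t _; rewrite lee_fin.
exists (geometric C (2^-1)); split.
- by move=> n; rewrite /geometric/= mulr_ge0// exprn_ge0.
- have -> : [normed series (geometric C 2^-1)] = series (geometric C 2^-1).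
    apply/funext => n; rewrite /series/=; apply: eq_bigr => i _.
    by rewrite ger0_norm// mulr_ge0// exprn_ge0.
  by apply: is_cvg_geometric_series; rewrite ger0_norm// invf_lt1// ltr1n.
move=> u Hu n.
have mk k : measurable (A (L k)) by exact: (mA _).1.
case: n => [|n].
  rewrite setD0 -massE// lee_fin (le_trans (mass_le_norm _ _))//.
  rewrite (le_trans (HM _ Hu))// (le_trans (ler_norm _))// /geometric/= expr1 /C.
  rewrite mulrDl mulrAC divff// mul1r lerDl; lra.
have mD : measurable (A (L n.+1) `\` A (L n)) by exact: measurableD.
rewrite -massE// lee_fin.
apply: (@le_trans _ _ (mass (~` A (L n)) u)); first by apply: le_mass => // t [].
apply: (le_trans (NP n _ Hu _ (LN n))).
rewrite /geometric /= exprVn !exprS /C.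
have e3 : 0 < 2 ^- n :> R by rewrite invr_gt0 exprn_gt0.
have -> : (2 * (2 * 2 ^+ n))^-1 = 2 ^- n / 4 :> R by field; rewrite expf_neq0.
have := normr_ge0 M.
nra.
Qed.

(** Outside of some [A N] the mass is small because of the summable bounds, and
    a subset of [A N] on which the integral of [w] is small has small measure. *)
Lemma equi_integrable_weighted_ui w H : weight mu w ->
  equi_integrable H -> weighted_ui w H.
Proof.
move=> ww [A [[A0 mA AS AT] [uiH [a [a0 ca tail]]]]] e e0.
have [mw w0 w1 iw] := ww.
have e20 : 0 < e / 2 by rewrite divr_gt0.
have Amono n m : (n <= m)%N -> A n `<=` A m.
  elim: m => [|m IH]; first by rewrite leqn0 => /eqP ->.
  by rewrite leq_eqVlt => /predU1P[->//|/IH]; move=> /subset_trans; exact.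
have mAn n : measurable (A n) by exact: (mA n).1.
have mAC n : measurable (~` A n) by apply: measurableC.
have AC t : \forall n \near \oo, ~ (~` A n) t.
  have : [set: T] t by [].
  rewrite -AT => -[N _ ANt]; exists N => // n /= Nn; apply.
  exact: Amono Nn _ ANt.
have [N NP] : exists N, forall m, (N <= m)%N -> \sum_(N <= k < m) a k.+1 <= e / 4.
  have e8 : 0 < e / 8 by rewrite divr_gt0.
  have /cvg_ex[l /cvgrPdist_lt/(_ _ e8)[N _ hN]] := ca.
  exists N => m Nm.
  have -> : \sum_(N <= k < m) a k.+1 =
      [normed series a] m.+1 - [normed series a] N.+1.
    rewrite sub_series ltnS Nm big_add1/=.
    by apply: eq_bigr => k _; rewrite ger0_norm.
  have := hN m.+1 (leqW Nm); have := hN N.+1 (leqnSn _).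
  by rewrite !ltr_norml => /andP[h1 h2] /andP[h3 h4]; lra.
have tailN u : H u -> mass (~` A N) u <= e / 4.
  move=> Hu.
  have step m : (N <= m)%N -> mass (A m `\` A N) u <= \sum_(N <= k < m) a k.+1.
    elim: m => [|m IH].
      by rewrite leqn0 => /eqP ->; rewrite setDv mass_set0 big_nil.
    rewrite leq_eqVlt => /predU1P[->|]; first by rewrite setDv mass_set0 big_geq.
    rewrite ltnS => Nm; rewrite big_nat_recr//=.
    apply: (@le_trans _ _ (mass ((A m `\` A N) `|` (A m.+1 `\` A m)) u)).
      apply: le_mass; [exact: measurableD| |].
        by apply: measurableU; exact: measurableD.
      move=> t [At nAt]; have [Amt|Amt] := pselect (A m t); [by left|by right].
    apply: (le_trans (massU_le _ _ _)); [exact: measurableD..|].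
    rewrite lerD ?IH// -lee_fin massE; last exact: measurableD.
    exact: tail.
  have := mass_cvg0 u mAC (aeW _ AC).
  move=> /cvgrPdist_lt c0; apply/ler_addgt0Pr => eps eps0.
  have [m0 _ hm] := c0 _ eps0.
  pose m := maxn m0 N.
  have := hm m (leq_maxl _ _); rewrite sub0r normrN ger0_norm ?mass_ge0// => hmm.
  have Nm : (N <= m)%N by exact: leq_maxr.
  apply: (@le_trans _ _ (mass ((A m `\` A N) `|` ~` A m) u)).
    apply: le_mass => //.
      by apply: measurableU => //; exact: measurableD.
    move=> t nAt; have [Amt|Amt] := pselect (A m t); [by left|by right].
  apply: (le_trans (massU_le _ _ _)) => //; first exact: measurableD.
  by apply: lerD; [exact: le_trans (step _ Nm) (NP _ Nm)|exact: ltW].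
have [delta d0 dP] := uiH _ e20.
(* the measure of a subset of [A N] is controlled by the integral of [w] *)
have i1 : mu.-integrable setT (EFin \o (\1_(A N) : T -> R)).
  apply/integrableP; split.
    by apply/measurable_EFinP; exact: measurable_indic.
  under eq_integral do rewrite /= ger0_norm//.
  by rewrite integral_indic ?setIT//; exact: (mA N).2.
have [|delta' d0' dP'] := weighted_absolute_continuity i1 _ mw w0 d0.
  by move=> t; rewrite indicE.
exists delta' => // u Hu B mB /(dP' _ mB) muB.
have mBA : measurable (B `&` A N) by exact: measurableI.
have : mass (B `&` A N) u < e / 2.
  rewrite -lte_fin massE//; apply: dP => //.
  apply: le_lt_trans muB.
  by rewrite integral_indic// setIC.
have := tailN _ Hu => h1 h2.
apply: (@le_lt_trans _ _ (mass ((B `&` A N) `|` ~` A N) u)).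
  apply: le_mass => //; first exact: measurableU.
  by move=> t Bt; have [At|At] := pselect (A N t); [left|right].
apply: (le_lt_trans (massU_le _ _ _)) => //.
lra.
Qed.

End weighted_uniform_integrability.

(** * Gliding hump *)

(** The terms of index [j] add up without cancellation; the others are bounded by
    the triangle inequality. *)
Lemma norm_sum_ge (R : realType) (E : normedModType R) (x : nat -> E) s j :
  \sum_(k <- s) (2 * (k == j)%:R - 1) * `|x k| <= `|\sum_(k <- s) x k| :> R.
Proof.
rewrite (bigID (pred1 j)) [in leRHS](bigID (pred1 j))/=.
have -> : \sum_(k <- s | k == j) (2 * (k == j)%:R - 1) * `|x k| =
    `|\sum_(k <- s | k == j) x k|.
  rewrite (eq_bigr (fun=> `|x j|)) => [|k /eqP ->]; last first.
    by rewrite eqxx (_ : true%:R = 1)//; ring.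
  rewrite [in RHS](eq_bigr (fun=> x j)) => [|k /eqP ->]//.
  by rewrite !big_const_seq !iter_addr_0 normrMn.
have -> : \sum_(k <- s | k != j) (2 * (k == j)%:R - 1) * `|x k| =
    - \sum_(k <- s | k != j) `|x k|.
  by rewrite -sumrN; apply: eq_bigr => k /negbTE ->; rewrite mulr0 sub0r mulN1r.
set S1 := (X in `|X| - _); set S2 := (X in _ <= `|_ + X|).
rewrite lerBlDr -[in leLHS](addrK S2 S1) (le_trans (ler_normB _ _))// lerD2l.
exact: ler_norm_sum.
Qed.

Section gliding_hump.
Context d (T : measurableType d) (R : realType) (X : normedModType R).
Variables (mu : {sigma_finite_measure set T -> \bar R}).
Implicit Types (w : T -> R) (B : set T) (H : set (L1 X mu)).

(** Were [H] not uniformly integrable, some [eta > 0] would be the supremum of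
    the masses that elements of [H] keep on arbitrarily small sets. Choose
    [u_n] in [H] whose mass on [B_n] is almost [eta], with [B_n] so small that
    [u_i] has little mass on it for [i < n], and that the union of all [B_n]
    is small. By maximality of [eta] the mass of [u_n] on this union is hardly
    more than [eta], so that on the disjoint sets
    [B_n `\` \bigcup_(j > n) B_j] the [u_n] behave like the basis of [l^1]:
    averages of far elements keep almost all of [eta] on the small sets
    [\bigcup_(k >= n) B_k], and cannot be close to a fixed function. *)
Lemma tail_hulls_meet_weighted_ui w H (M : R) : weight mu w ->
  (forall u, H u -> `|u| <= M) -> tail_hulls_meet H -> weighted_ui w H.
Proof.
move=> ww HM meetH; have [mw w0 w1 iw] := ww.
pose lam B := (\int[mu]_(t in B) (w t)%:E)%E.
apply: contrapT => nui.
pose S := [set a : R | forall delta : R, 0 < delta -> exists u B,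
  [/\ H u, measurable B, (lam B < delta%:E)%E & a <= mass B u]].
have [e0 e0p Se0] : exists2 e0 : R, 0 < e0 & S e0.
  apply: contrapT => nS; apply: nui => e e0.
  apply: contrapT => nd; apply: nS; exists e => // delta d0.
  apply: contrapT => nuB; apply: nd; exists delta => // u Hu B mB Bd.
  rewrite ltNge; apply/negP => eB; apply: nuB; by exists u, B.
have Sub : ubound S M.
  move=> a /(_ 1 ltr01)[u [B [Hu mB _ aB]]].
  by rewrite (le_trans aB)// (le_trans (mass_le_norm _ mB))// HM.
have hsS : has_sup S by split; [exists e0|exists M].
pose eta := sup S.
have eta0 : 0 < eta by rewrite (lt_le_trans e0p)//; apply: ub_le_sup => //; exists M.
pose e := eta / 10.
have ep : 0 < e by rewrite divr_gt0.
have low delta : 0 < delta -> exists u B,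
    [/\ H u, measurable B, (lam B < delta%:E)%E & eta - e <= mass B u].
  have [a Sa ea] := sup_adherent ep hsS.
  move=> /Sa[u [B [Hu mB Bd aB]]]; exists u, B; split=> //.
  by rewrite (le_trans _ aB)// ltW.
have [delta d0 high] : exists2 delta : R, 0 < delta & forall u B, H u ->
    measurable B -> (lam B < delta%:E)%E -> mass B u < eta + e.
  apply: contrapT => nd.
  have : S (eta + e).
    move=> delta d0; apply: contrapT => nuB; apply: nd; exists delta => // u B Hu mB Bd.
    by rewrite ltNge; apply/negP => h; apply: nuB; exists u, B.
  move=> Se; have : eta + e <= eta by apply: ub_le_sup => //; exists M.
  by rewrite gerDl leNgt ep.
pose Q (l : seq (L1 X mu * set T)) (a : L1 X mu * set T) :=
  [/\ H a.1, measurable a.2, (lam a.2 <= (delta / 2 / (2 ^ (size l).+1)%:R)%:E)%E,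
    eta - e <= mass a.2 a.1 &
    forall p, p \in l -> mass a.2 p.1 <= e / (2 ^ (size l).+1)%:R].
have [l|a Qa] := @history_choice _ Q.
  pose r : R := e / (2 ^ (size l).+1)%:R.
  have r0 : 0 < r by rewrite divr_gt0// ltr0n expn_gt0.
  have [delta' d'0 small] : exists2 delta' : R, 0 < delta' & forall p, p \in l ->
      forall B, measurable B -> (lam B < delta'%:E)%E -> mass B p.1 < r.
    clear Q; clearbody r; elim: l => [|p l IH]; first by exists 1.
    have [d1 d10 h1] := IH.
    have [d2 d20 h2] := mass_weight p.1 ww r0.
    exists (Num.min d1 d2); first by rewrite lt_min d10.
    move=> q; rewrite inE => /predU1P[->|ql] B mB.
      by move=> Bd; apply: h2 => //; apply: lt_le_trans Bd _; rewrite lee_fin ge_min lexx orbT.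
    by move=> Bd; apply: (h1 _ ql) => //; apply: lt_le_trans Bd _; rewrite lee_fin ge_min lexx.
  have [|u [B [Hu mB Bd uB]]] := low (Num.min delta' (delta / 2 / (2 ^ (size l).+1)%:R)).
    by rewrite lt_min d'0 !divr_gt0// ltr0n expn_gt0.
  exists (u, B); split=> //=.
    by apply: ltW; apply: lt_le_trans Bd _; rewrite lee_fin ge_min lexx orbT.
  move=> p pl; apply/ltW/(small _ pl) => //.
  by apply: lt_le_trans Bd _; rewrite lee_fin ge_min lexx.
pose u n := (a n).1; pose B n := (a n).2.
have Hu n : H (u n) by have [] := Qa n.
have mB n : measurable (B n) by have [] := Qa n.
have lamB n : (lam (B n) <= (delta / 2 / (2 ^ n.+1)%:R)%:E)%E.
  by have [_ _ + _ _] := Qa n; rewrite size_mkseq.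
have uB n : eta - e <= mass (B n) (u n) by have [] := Qa n.
have uBi n i : (i < n)%N -> mass (B n) (u i) <= e / (2 ^ n.+1)%:R.
  move=> ni; have [_ _ _ _] := Qa n; rewrite size_mkseq => /(_ (a i)); apply.
  by apply: map_f; rewrite mem_iota.
(* The small sets on which the averages of far elements keep their mass, and
   the disjoint pieces that carry it. *)
pose D n := \bigcup_j B (n + j)%N.
have mD n : measurable (D n) by apply: bigcupT_measurable.
have lamD n : (lam (D n) <= (delta / 2 / (2 ^ n)%:R)%:E)%E.
  apply: integral_bigcup_le => //.
  - by move=> t; exact: ltW.
  - by rewrite !divr_ge0// ltW.
  - move=> j; apply: le_trans (lamB _) _; rewrite lee_fin -addnS expnD natrM.
    by rewrite invfM mulrA.
have DS n k : (n <= k)%N -> B k `<=` D n.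
  by move=> nk t Bkt; exists (k - n)%N => //=; rewrite subnKC.
pose E k := B k `\` D k.+1.
have mE k : measurable (E k) by exact: measurableD.
have tE : trivIset setT E.
  move=> i j _ _ [t [[Bit nDi] [Bjt nDj]]].
  have [ij|ji|//] := ltngtP i j.
    by exfalso; apply: nDi; apply: DS ij _ Bjt.
  by exfalso; apply: nDj; apply: DS ji _ Bit.
have massD k : mass (D k.+1) (u k) <= e.
  rewrite -lee_fin mass_mnorm//; apply: integral_bigcup_le => //.
  - exact: measurable_mnorm.
  - exact: mnorm_ge0.
  - exact: ltW.
  move=> j; rewrite -mass_mnorm// lee_fin.
  apply: (le_trans (uBi _ _ _)); first by rewrite addSn ltnS leq_addr.
  rewrite ler_pM2l// lef_pV2 ?posrE ?ltr0n ?expn_gt0//.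
  by rewrite ler_nat leq_exp2l// ltnS leq_addl.
have massE k : eta - 2 * e <= mass (E k) (u k).
  have := uB k; have := massD k.
  have : mass (B k) (u k) <= mass (E k) (u k) + mass (D k.+1) (u k).
    apply: le_trans (massU_le _ (mE k) (mD _)).
    apply: le_mass => //; first exact: measurableU.
    by move=> t Bt; have [Dt|Dt] := pselect (D k.+1 t); [right|left].
  lra.
have massD0 n k : (n <= k)%N -> mass (D n) (u k) < eta + e.
  move=> nk; apply: high => //; apply: le_lt_trans (lamD n) _.
  rewrite lte_fin ltr_pdivrMr ?ltr0n ?expn_gt0//.
  rewrite ltr_pdivrMr// -mulrA ltr_pMr//.
  by rewrite -natrM ltr1n mulnC (@leq_mul 2 1)// expn_gt0.
have avg n s : s != [::] -> all (leq n) s -> eta - 5 * e <= mass (D n) (average u s).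
  move=> s0 ns.
  have [N sN] : exists N, forall k, k \in s -> (k < N)%N.
    elim: s {s0 ns} => [|k s [N IH]]; first by exists 0%N.
    exists (maxn k.+1 N) => j; rewrite inE leq_max => /predU1P[->|/IH ->].
      by rewrite leqnn.
    by rewrite orbT.
  pose E' k := if (n <= k)%N then E k else set0.
  have mE' k : measurable (E' k) by rewrite /E'; case: ifP.
  have tE' : trivIset setT E'.
    move=> i j _ _; rewrite /E'; case: ifP => ni; case: ifP => nj; rewrite ?setI0 ?set0I; try by case.
    by move=> /tE; exact.
  have E'D k : E' k `<=` D n.
    by move=> t; rewrite /E'; case: ifP => [nk [Bt _]|_ []]; apply: (DS _ _ nk).
  have ss : 0 < (size s)%:R :> R by rewrite ltr0n lt0n size_eq0.
  rewrite massZ// ger0_norm ?invr_ge0// ler_pdivlMl//.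
  apply: le_trans (mass_trivIset N _ mE' (mD n) tE' E'D).
  have -> : (size s)%:R * (eta - 5 * e) = \sum_(k <- s) (eta - 5 * e).
    by rewrite big_const_seq count_predT iter_addr_0 mulr_natl.
  apply: (@le_trans _ _ (\sum_(j < N) \sum_(k <- s)
      (2 * (k == j :> nat)%:R - 1) * mass (E' j) (u k))); last first.
    apply: ler_sum => j _.
    have := norm_sum_ge (fun k => restr (E' j) (u k)) s j.
    rewrite -restr_sum// norm_restr.
    by under eq_bigr do rewrite norm_restr.
  rewrite exchange_big/= big_seq [in leRHS]big_seq; apply: ler_sum => k ks.
  have kN := sN _ ks.
  have nk : (n <= k)%N by move/allP: ns; apply.
  have -> : \sum_(j < N) (2 * (k == j :> nat)%:R - 1) * mass (E' j) (u k) =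
      2 * mass (E' k) (u k) - \sum_(j < N) mass (E' j) (u k).
    under eq_bigr do rewrite mulrBl mul1r.
    rewrite sumrB; congr (_ - _).
    rewrite (bigD1 (Ordinal kN))//= eqxx mulr1 big1 ?addr0// => j.
    rewrite -val_eqE/= => /negbTE; rewrite eq_sym => ->.
    by rewrite mulr0 mul0r.
  have := mass_trivIset N (u k) mE' (mD n) tE' E'D.
  have := massD0 _ _ nk; have := massE k.
  rewrite {2}/E' nk; lra.
have [g gP] := meetH _ Hu.
have [delta1 d10 gsmall] := mass_weight g ww ep.
have [n nd] : exists n, delta / 2 / (2 ^ n)%:R < delta1.
  exists (Num.bound (delta / 2 / delta1)).
  rewrite ltr_pdivrMr ?ltr0n ?expn_gt0// [X in _ < X]mulrC -ltr_pdivrMr//.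
  have q0 : 0 <= delta / 2 / delta1 by apply: ltW; rewrite !divr_gt0.
  apply: (lt_trans (archi_boundP q0)).
  by rewrite ltr_nat ltn_expl.
have [h hh hg] := gP n _ ep.
have [s [s0 ns hs]] := convex_hull_average ep hh.
have := avg n s s0 ns.
have := massB_le h g (mD n).
have := massB_le (average u s) h (mD n).
have : mass (D n) g < e.
  apply: gsmall => //; apply: le_lt_trans (lamD n) _.
  by rewrite lte_fin.
rewrite distrC in hs.
by rewrite /e in hg hs *; lra.
Qed.

End gliding_hump.

(** * Convergence in [L^1] and almost everywhere *)

Section L1_convergence.
Context d (T : measurableType d) (R : realType) (X : normedModType R).
Variable mu : {measure set T -> \bar R}.
Local Notation L1 := (L1 X mu).
Implicit Types (u g : L1) (v : nat -> L1).

Lemma L1_dominated v u (F : T -> R) :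
  {ae mu, forall t, v n t @[n --> \oo] --> u t} ->
  mu.-integrable setT (EFin \o F) ->
  (forall n, {ae mu, forall t, `|v n t - u t| <= F t}) ->
  `|v n - u| @[n --> \oo] --> (0 : R).
Proof.
move=> vu iF vF.
pose G n := mnorm mu (v n - u : L1).
have GE n : {ae mu, forall t, `|v n t - u t| = G n t}.
  have [_ _] := mnormP (L1_integrable (v n - u)).1.
  by apply: filterS2 (L1_subE (v n) u) => t ->.
have m1 n : measurable_fun setT (EFin \o G n) by exact: measurable_mnormE.
have c1 : {ae mu, forall t, setT t -> (EFin \o G n) t @[n --> \oo] --> 0%E}.
  apply: filterS2 vu (ae_foralln GE) => t ut Gt _.
  apply/fine_cvgP; split; first exact: nearW.
  rewrite /=; under eq_fun do rewrite /= -Gt.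
  suff : `|v n t - u t| @[n --> \oo] --> `|u t - u t| by rewrite subrr normr0.
  by apply: cvg_norm; apply: cvgB => //; exact: cvg_cst.
have d1 : {ae mu, forall t n, setT t -> (`|(EFin \o G n) t| <= (EFin \o F) t)%E}.
  apply: filterS2 (ae_foralln vF) (ae_foralln GE) => t Ft Gt n _ /=.
  by rewrite lee_fin -Gt normr_id Ft.
have [_ _] := dominated_convergence measurableT m1 (measurable_cst 0%E) c1 iF d1.
rewrite integral0.
suff -> : [sequence (\int[mu]_x (EFin \o G n) x)%E]_n = EFin \o (fun n => `|v n - u|).
  by move/fine_cvgP => [_].
by apply/funext => n; rewrite /= L1_norm_mnorm.
Qed.

(** Fatou's lemma; the pointwise hypothesis also holds for weak limits. *)
Lemma fatou_norm v (g : T -> X) (C : R) : strongly_measurable mu g ->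
  {ae mu, forall t (e : R), 0 < e ->
     \forall n \near \oo, `|g t| <= `|v n t| + e} ->
  (forall n, `|v n| <= C) ->
  (\int[mu]_t `|g t|%:E <= C%:E)%E.
Proof.
move=> mg vg vC; rewrite integral_mnorm//.
have m1 n : measurable_fun setT (EFin \o mnorm mu (v n)) by exact: measurable_mnormE.
pose L t := limn_einf ((fun n => EFin \o mnorm mu (v n))^~ t).
have mL : measurable_fun setT L.
  rewrite (_ : L = \- (fun t => limn_esup ((fun n t => - (mnorm mu (v n) t)%:E)^~ t)))%E.
    apply: measurableT_comp => //; apply: measurable_fun_limn_esup => n.
    by apply: measurableT_comp => //; exact: measurable_mnormE.
  by apply/funext => t; rewrite /= -limn_einfN; congr limn_einf; apply/funext => n /=; rewrite opprK.
have L0 t : (0 <= L t)%E.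
  rewrite /L limn_einf_lim; apply: lime_ge; first exact: is_cvg_einfs.
  apply: nearW => n; apply: le_ereal_inf_tmp => _ [k _ <-].
  by rewrite /= lee_fin mnorm_ge0.
apply: (@le_trans _ _ (\int[mu]_t L t)%E).
  apply: ae_ge0_le_integral => //.
  - by move=> t _; rewrite lee_fin mnorm_ge0.
  - exact: measurable_mnormE.
  have [_ _ gE] := mnormP mg.
  have vE n : {ae mu, forall t, `|v n t| = mnorm mu (v n) t}.
    by have [] := mnormP (L1_integrable (v n)).1.
  apply: filterS3 vg gE (ae_foralln vE) => t vt gt vEt _.
  apply/lee_addgt0Pr => e e0; rewrite -leeBlDr// -EFinB /L limn_einf_lim.
  apply: lime_ge; first exact: is_cvg_einfs.
  have [N _ hN] := vt _ e0; exists N => // n /= Nn.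
  apply: le_ereal_inf_tmp => _ [k /= nk <-].
  rewrite lee_fin lerBlDr -gt -vEt; apply: hN => /=.
  exact: leq_trans Nn nk.
have := fatou mu measurableT m1 (fun n t _ => ltac:(by rewrite lee_fin mnorm_ge0)).
move=> /le_trans; apply; rewrite limn_einf_lim.
apply: lime_le; first exact: is_cvg_einfs.
apply: nearW => n; apply: ge_ereal_inf; exists (`|v n|%:E); last by rewrite lee_fin.
by exists n => //=; rewrite L1_norm_mnorm.
Qed.

Lemma near_norm_le (x : nat -> X) y : x n @[n --> \oo] --> y ->
  forall e : R, 0 < e -> \forall n \near \oo, `|y| <= `|x n| + e.
Proof.
move=> /cvgrPdist_lt xy e /xy; apply: filterS => n h.
by rewrite -[y in leLHS](subrK (x n)) addrC (le_trans (ler_normD _ _))// lerD2l ltW.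
Qed.

(** Simple functions are dense. The pointwise approximations [s_n] of [u] are
    cut off where their norm exceeds twice the norm of [u], which makes them
    dominated. *)
Lemma simple_dense u (e : R) : 0 < e -> exists v : L1,
  `|v - u| < e /\ exists2 s, simple_function s & {ae mu, forall t, v t = s t}.
Proof.
move=> e0; have [[s [ss su]] _] := L1_integrable u.
have [mF F0 uF] := mnormP (L1_integrable u).1.
set F := mnorm mu u in mF F0 uF.
pose B n := [set t | `|s n t| <= 2 * F t].
have ms n : measurable_fun setT (fun t => `|s n t|).
  move=> _ Y mY; rewrite setTI.
  exact: (simple_preimage [set x : X | Y `|x|] (ss n)).
have m2F : measurable_fun setT (fun t => 2 * F t).
  by apply: measurable_funM => //; exact: measurable_cst.
have mB n : measurable (B n).
  by rewrite -[B n]setTI; exact: measurable_fun_ler.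
pose s' n t := (\1_(B n) t : R) *: s n t.
have ss' n : simple_function (s' n).
  by apply: (simple_op2 (fun a x => a *: x)) => //; exact: simple_indic.
have s'F n t : `|s' n t| <= 2 * F t.
  rewrite /s' normrZ indicE; case: (boolP (t \in B n)) => [|_].
    by rewrite inE normr1 mul1r.
  by rewrite normr0 mul0r mulr_ge0.
have i2F : mu.-integrable setT (EFin \o (fun t => 2 * F t)).
  by have := integrableZl measurableT 2 (integrable_mnorm u).
have is' n : bochner_integrable mu (s' n).
  split; first by exists (fun=> s' n); split=> //; apply: aeW => t; exact: cvg_cst.
  have /integrableP[_] := i2F; apply: le_lt_trans.
  apply: ge0_le_integral => //.
  - apply/measurable_EFinP => _ Y mY; rewrite setTI.
    exact: (simple_preimage [set x : X | Y `|x|] (ss' n)).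
  - by apply: measurableT_comp => //; exact/measurable_EFinP.
  by move=> t _; rewrite /= lee_fin (le_trans (s'F n t))// ler_norm.
pose v n := mkL1 mu (s' n).
have vE n : {ae mu, forall t, v n t = s' n t} by exact: mkL1E.
have : `|v n - u| @[n --> \oo] --> (0 : R).
  apply: (@L1_dominated _ _ (fun t => 3 * F t)).
  - apply: filterS3 su uF (ae_foralln vE) => t st ut vt.
    under eq_fun do rewrite vt /s'.
    have [u0|u0] := eqVneq (u t) 0.
      rewrite u0; apply: cvg_near_cst; apply: nearW => n.
      rewrite indicE; case: (boolP (t \in B n)) => [|_]; last by rewrite scale0r.
      rewrite inE /B/= -ut u0 normr0 mulr0 normr_le0 => /eqP ->.
      by rewrite scaler0.
    apply: cvg_trans (st); apply: near_eq_cvg.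
    have : \forall n \near \oo, `|s n t| <= 2 * F t.
      apply: filterS (cvgr_lt (`|u t|) (cvg_norm st) (2 * F t) _).
        by move=> n /ltW.
      by rewrite -ut ltr_pMl ?normr_gt0// ltr1n.
    apply: filterS => n sn; rewrite indicE mem_set ?scale1r//.
  - by have := integrableZl measurableT 3 (integrable_mnorm u).
  - move=> n; apply: filterS2 uF (vE n) => t ut ->.
    apply: (le_trans (ler_normB _ _)); rewrite ut.
    by have := s'F n t; lra.
move=> /cvgrPdist_lt/(_ _ e0)[n _ /(_ n (leqnn n))].
rewrite sub0r normrN normr_id => vn.
by exists (v n); split=> //; exists (s' n).
Qed.

(** The sum of the norms has a finite integral, hence is finite almost
    everywhere. *)
Lemma ae_summable v : (forall k, `|v k| <= 2 ^- k) ->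
  {ae mu, forall t, cvgn [normed series (v ^~ t)]}.
Proof.
move=> v2.
pose h n t := (mnorm mu (v n) t)%:E.
have h0 n t : (0 <= h n t)%E by rewrite lee_fin mnorm_ge0.
have mh n : measurable_fun setT (h n) by exact: measurable_mnormE.
pose W t := (\sum_(n <oo) h n t)%E.
have iW : mu.-integrable setT W.
  apply/integrableP; split; first exact: ge0_emeasurable_sum.
  under eq_integral do rewrite gee0_abs ?nneseries_ge0//.
  rewrite integral_nneseries//.
  apply: le_lt_trans (ltry 2); apply: le_trans (epsilon_trick0 xpredT _) => //.
  apply: lee_nneseries => [n _ _|n _]; first exact: integral_ge0.
  rewrite -L1_norm_mnorm lee_fin (le_trans (v2 n))// natrX exprS invfM mulrA.
  by rewrite divff// mul1r.
have vE n : {ae mu, forall t, `|v n t| = mnorm mu (v n) t}.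
  by have [] := mnormP (L1_integrable (v n)).1.
apply: filterS2 (integrable_ae measurableT iW) (ae_foralln vE) => t /(_ I) Wt vt.
apply: nondecreasing_is_cvgn.
  move=> m n mn; rewrite -subr_ge0 sub_series mn.
  by apply: sumr_ge0 => i _; rewrite normr_ge0.
exists (fine (W t)) => _ [n _ <-].
rewrite -lee_fin fineK// /series/= -sumEFin.
apply: le_trans (nneseries_lim_ge n _) => //.
by apply: lee_sum => i _; rewrite /h -vt.
Qed.

Lemma ae_cvg_of_norm v u : (forall k, `|v k - u| <= 2 ^- k) ->
  {ae mu, forall t, v n t @[n --> \oo] --> u t}.
Proof.
move=> /ae_summable h; apply: filterS2 h (ae_foralln (fun k => L1_subE (v k) u)).
move=> t /cvg_series_cvg_0 c0 vE.
apply/cvgrPdist_lt => e e0; have /cvgrPdist_lt/(_ _ e0) := c0.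
by apply: filterS => n; rewrite sub0r normrN normr_id vE distrC.
Qed.

(** Simple functions at distance [2 ^- n] from [v n] in [L^1] have the same limit
    almost everywhere. *)
Lemma strongly_measurable_limit v (g : T -> X) :
  {ae mu, forall t, v n t @[n --> \oo] --> g t} -> strongly_measurable mu g.
Proof.
move=> vg.
have /choice[p pP] : forall n, exists p : L1 * (T -> X),
    [/\ `|p.1 - v n| <= 2 ^- n, simple_function p.2 & {ae mu, forall t, p.1 t = p.2 t}].
  move=> n; have [|p [pv [s ss ps]]] := @simple_dense (v n) (2 ^- n).
    by rewrite invr_gt0 exprn_gt0.
  by exists (p, s); split=> //; exact: ltW.
exists (fun n => (p n).2); split; first by move=> n; have [] := pP n.
have /ae_summable h : forall n, `|(p n).1 - v n| <= 2 ^- n by move=> n; have [] := pP n.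
have pE n : {ae mu, forall t, (p n).1 t = (p n).2 t} by have [] := pP n.
apply: filterS2 (filterI h vg) (filterI (ae_foralln pE)
  (ae_foralln (fun n => L1_subE (p n).1 (v n)))) => t [ht vt] [pt dt].
have := cvg_series_cvg_0 ht => c0.
have c1 : (p n).2 t - v n t @[n --> \oo] --> 0.
  apply/cvgrPdist_lt => e e0; have /cvgrPdist_lt/(_ _ e0) := c0.
  by apply: filterS => n; rewrite !sub0r !normrN normr_id dt pt.
rewrite (_ : (fun n => (p n).2 t) = (fun n => ((p n).2 t - v n t) + v n t)).
  by rewrite -[g t]add0r; exact: cvgD.
by apply/funext => n; rewrite subrK.
Qed.

End L1_convergence.

Section L1_complete.
Context d (T : measurableType d) (R : realType) (X : completeNormedModType R).
Variable mu : {measure set T -> \bar R}.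

(** The Riesz-Fischer theorem. *)
Lemma L1_complete (u : nat -> L1 X mu) : (forall n, `|u n.+1 - u n| <= 2 ^- n) ->
  cvgn u.
Proof.
move=> u2.
have h := ae_summable u2.
pose g t := lim (u n t @[n --> \oo]).
have ug : {ae mu, forall t, u n t @[n --> \oo] --> g t}.
  apply: filterS2 h (ae_foralln (fun k => L1_subE (u k.+1) (u k))).
  move=> t ht ut; apply/cvg_ex.
  have /cvg_ex[l hl] := normed_cvg ht.
  exists (l + u 0%N t).
  have : series (fun k => (u k.+1 - u k : L1 X mu) t) n + u 0%N t @[n --> \oo] --> l + u 0%N t.
    by apply: cvgD => //; exact: cvg_cst.
  apply: cvg_trans; apply: near_eq_cvg; apply: nearW => n.
  rewrite /series/=; under eq_bigr do rewrite ut.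
  by rewrite telescope_sumr// subrK.
have mg : strongly_measurable mu g by exact: strongly_measurable_limit ug.
have um n m : (n <= m)%N -> `|u m - u n| <= 2 * 2 ^- n.
  move=> nm; suff : `|u m - u n| <= 2 * 2 ^- n - 2 * 2 ^- m.
    by move=> /le_trans; apply; rewrite gerBl mulr_ge0// invr_ge0 exprn_ge0.
  elim: m nm => [|m IH]; first by rewrite leqn0 => /eqP ->; rewrite !subrr normr0.
  rewrite leq_eqVlt => /predU1P[->|]; first by rewrite !subrr normr0.
  rewrite ltnS => /IH {}IH.
  rewrite -[u m.+1](subrK (u m)) -addrA (le_trans (ler_normD _ _))//.
  have -> : 2 * 2 ^- m.+1 = 2 ^- m :> R by rewrite exprS invfM mulrA divff// mul1r.
  by have := u2 m; lra.
have ig : bochner_integrable mu g.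
  split=> //; apply: le_lt_trans (ltry (`|u 0%N| + 2)).
  apply: (fatou_norm (v := u) mg) => [|n].
    by apply: filterS ug => t; exact: near_norm_le.
  rewrite -[u n](subrK (u 0%N)) addrC (le_trans (ler_normD _ _))// lerD2l.
  by have := um 0%N n (leq0n _); rewrite expr0 invr1 mulr1.
pose G : L1 X mu := mkL1 mu g.
have GE : {ae mu, forall t, G t = g t} by exact: mkL1E.
have uG n : `|u n - G| <= 2 * 2 ^- n.
  rewrite -lee_fin L1_normE.
  apply: (@fatou_norm _ _ _ _ _ (fun m => u n - u (n + m)%N)).
  - exact: (L1_integrable (u n - G)).1.
  - apply: filterS3 (filterI ug GE) (L1_subE (u n) G)
      (ae_foralln (fun m => L1_subE (u n) (u (n + m)%N))).
    move=> t [ut Gt] -> um'; apply: near_norm_le; under eq_fun do rewrite um'.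
    apply: cvgB; first exact: cvg_cst.
    rewrite Gt; apply: (cvg_comp (addn n) (fun m => u m t)) ut.
    exact: cvg_addnl.
  - by move=> m; rewrite distrC um// leq_addr.
apply/cvg_ex; exists G; apply/cvgrPdist_lt => e e0.
near=> n; rewrite distrC (le_lt_trans (uG n))//.
rewrite -ltr_pdivlMl// mulrC -div1r.
by near: n; apply: (near_infty_natSinv_expn_lt (PosNum (divr_gt0 e0 _))).
Unshelve. all: by end_near. Qed.

End L1_complete.

(** * Functionals on [L^1] along countably many functions *)

Lemma ae_forall_countable d (T : measurableType d) (R : realType)
    (mu : {measure set T -> \bar R}) (I : countType) (P : I -> T -> Prop) :
  (forall i, {ae mu, forall t, P i t}) -> {ae mu, forall t, forall i, P i t}.
Proof.
move=> aeP.
have : {ae mu, forall t n, if unpickle n is Some i then P i t else True}.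
  apply: ae_foralln => n; case: (unpickle n) => [i|]; first exact: aeP.
  exact: aeW.
by apply: filterS => t h i; have := h (pickle i); rewrite pickleK.
Qed.

Section density.
Context d (T : measurableType d) (R : realType) (X : normedModType R).
Variable mu : {sigma_finite_measure set T -> \bar R}.
Local Notation L1 := (L1 X mu).
Implicit Types (u v : L1) (B : set T).

Lemma restr_set0 u : restr set0 u = 0.
Proof. by apply/normr0_eq0; rewrite norm_restr mass_set0. Qed.

Lemma restr_bigcup_cvg u (F : nat -> set T) : (forall i, measurable (F i)) ->
  trivIset setT F ->
  `|restr (\bigcup_n F n) u - \sum_(0 <= i < n) restr (F i) u| @[n --> \oo]
    --> (0 : R).
Proof.
move=> mF tF.
pose D n := \bigcup_i F (n + i)%N.
have mD n : measurable (D n) by exact: bigcupT_measurable.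
have E n : restr (\bigcup_i F i) u = \sum_(0 <= i < n) restr (F i) u + restr (D n) u.
  elim: n => [|n IH]; first by rewrite big_geq// add0r.
  rewrite IH big_nat_recr//= -addrA; congr (_ + _).
  have -> : D n = F n `|` D n.+1.
    apply/seteqP; split=> t.
      move=> [[|i] _]; first by rewrite addn0; left.
      by rewrite addnS -addSn => h; right; exists i.
    move=> [h|[i _ h]]; first by exists 0%N => //; rewrite addn0.
    by exists i.+1 => //; rewrite addnS -addSn.
  rewrite restrU//; apply/seteqP; split=> // t [Fnt [i _ Fit]].
  have := tF n (n.+1 + i)%N I I (ex_intro _ t (conj Fnt Fit)).
  by move/eqP; rewrite addSn -addnS -{1}(addn0 n) eqn_add2l.
have -> : (fun n => `|restr (\bigcup_n F n) u - \sum_(0 <= i < n) restr (F i) u|) =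
    (fun n => mass (D n) u).
  by apply/funext => n; rewrite {1}(E n) addrC addKr norm_restr.
apply: mass_cvg0 => //; apply: aeW => t.
have [[i Fit]|nF] := pselect (exists i, F i t).
  exists i.+1 => // n /= ni [j _ Fjt].
  have := tF i (n + j)%N I I (ex_intro _ t (conj Fit Fjt)).
  by move=> ij; move: ni; rewrite ij ltnNge leq_addr.
by apply: nearW => n [j _ Fjt]; apply: nF; exists (n + j)%N.
Qed.

(** The Radon-Nikodym theorem applied to [B |-> phi (restr B u)]. *)
Lemma exists_density (phi : L1 -> R) u : bounded_functional 1 phi ->
  exists psi : T -> R, mu.-integrable setT (EFin \o psi) /\
    forall B, measurable B ->
      ((phi (restr B u))%:E = \int[mu]_(t in B) (psi t)%:E)%E.
Proof.
move=> [_ lphi bphi].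
pose nu0 B : \bar R := (phi (restr B u))%:E.
have nu00 : nu0 set0 = 0%E by rewrite /nu0 restr_set0 functional0.
have nu0fin B : measurable B -> nu0 B \is a fin_num by [].
have nu0s : semi_sigma_additive nu0.
  move=> F mF tF _.
  rewrite (_ : (fun n => _) =
    EFin \o (fun n => phi (\sum_(0 <= i < n) restr (F i) u))); last first.
    by apply/funext => n; rewrite /= /nu0 sumEFin functional_sum.
  apply/fine_cvgP; split; first exact: nearW.
  apply/cvgrPdist_lt => e e0.
  have /cvgrPdist_lt/(_ _ e0) := restr_bigcup_cvg u mF tF.
  apply: filterS => n; rewrite sub0r normrN normr_id => h.
  by rewrite /= -functionalB// (le_lt_trans (bphi _))// mul1r.
pose nu : {charge set T -> \bar R} :=
  HB.pack nu0 (isCharge.Build _ T R nu0 nu00 nu0fin nu0s).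
have numu : nu `<< mu.
  apply/null_content_dominatesP => B mB muB0.
  suff B0 : restr B u = 0 by rewrite /= /nu0 B0 functional0.
  apply/normr0_eq0; rewrite norm_restr; apply: EFin_inj; rewrite mass_mnorm//.
  apply: null_set_integral => //.
  by apply: measurable_funTS; exact: measurable_mnormE.
pose f := Radon_Nikodym nu mu.
have fE : EFin \o (fine \o f) = f.
  by apply/funext => t /=; rewrite fineK// Radon_Nikodym_fin_num.
exists (fine \o f); split; first by rewrite fE; exact: Radon_Nikodym_integrable.
move=> B mB; rewrite -[LHS]/(nu B) (Radon_Nikodym_integral numu mB).
by apply: eq_integral => t _; rewrite -[in LHS]/f -[in LHS]fE.
Qed.

Section functional.
Variable phi : L1 -> R.
Hypothesis bphi : bounded_functional 1 phi.

Let dens u : T -> R := projT1 (cid (exists_density u bphi)).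

Let dens_int u : mu.-integrable setT (EFin \o dens u).
Proof. by rewrite /dens; case: cid => ? []. Qed.

Let densE u B : measurable B ->
  ((phi (restr B u))%:E = \int[mu]_(t in B) (dens u t)%:E)%E.
Proof. by move=> mB; rewrite /dens; case: cid => psi [_ h] /=; exact: h. Qed.

Let densB u v : {ae mu, forall t, dens (u - v) t = dens u t - dens v t}.
Proof.
have iB : mu.-integrable setT (fun t => ((EFin \o dens u) t - (EFin \o dens v) t)%E).
  exact: (integrableB measurableT (dens_int u) (dens_int v)).
suff : ae_eq mu setT (EFin \o dens (u - v))
    (fun t => ((EFin \o dens u) t - (EFin \o dens v) t)%E).
  by apply: filterS => t /(_ I) [].
apply: integral_ae_eq => // [|B _ mB]; first exact: measurable_int iB.
rewrite integralB//; last 2 first.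
- exact: integrableS (dens_int _).
- exact: integrableS (dens_int _).
have [_ lphi _] := bphi.
by rewrite -!densE// restrB// functionalB.
Qed.

Let dens_sum s (f : nat -> L1) :
  {ae mu, forall t, dens (\sum_(k <- s) f k) t = \sum_(k <- s) dens (f k) t}.
Proof.
have dens0 : {ae mu, forall t, dens 0 t = 0}.
  by have := densB 0 0; rewrite subrr; apply: filterS => t ->; rewrite subrr.
have densD u v : {ae mu, forall t, dens (u + v) t = dens u t + dens v t}.
  have := densB u (- v); rewrite opprK; have := densB 0 v; rewrite sub0r.
  by apply: filterS3 dens0 => t h0 h1 ->; rewrite h1 h0 sub0r opprK.
elim: s => [|k s IH].
  by rewrite big_nil; apply: filterS dens0 => t ->; rewrite big_nil.
rewrite big_cons; apply: filterS2 IH (densD (f k) (\sum_(k <- s) f k)).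
by move=> t h ->; rewrite h big_cons.
Qed.

Let dens_le u : {ae mu, forall t, dens u t <= mnorm mu u t}.
Proof.
pose B := [set t | mnorm mu u t < dens u t].
have md : measurable_fun setT (dens u).
  by apply/measurable_EFinP; exact: measurable_int (dens_int u).
have mB : measurable B.
  rewrite -[B]setTI; apply: measurable_fun_ltr => //; exact: measurable_mnorm.
pose h t := ((EFin \o dens u) t - (EFin \o mnorm mu u) t)%E.
have ih : mu.-integrable setT h.
  by apply: integrableB => //; exact: integrable_mnorm.
have mh : measurable_fun B h by apply: measurable_funTS; exact: measurable_int ih.
have : (\int[mu]_(t in B) `|h t| = 0)%E.
  apply/eqP; rewrite eq_le; apply/andP; split; last exact: integral_ge0.
  rewrite (eq_integral h); last first.
    move=> t; rewrite inE => Bt; rewrite gee0_abs// /h /= -EFinB lee_fin subr_ge0.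
    exact: ltW.
  rewrite integralB//; last 2 first.
    exact: integrableS (dens_int _).
    by apply: integrableS (integrable_mnorm u).
  rewrite -densE// -mass_mnorm// -EFinB lee_fin subr_le0 -norm_restr.
  have [_ _ b] := bphi.
  by rewrite (le_trans (ler_norm _))// (le_trans (b _))// mul1r.
move=> /(ae_eq_integral_abs mu mB mh); apply: filterS => t ht.
rewrite leNgt; apply/negP => Bt; have := ht Bt.
rewrite /h /= -EFinB => -[] /eqP; rewrite subr_eq0 => /eqP e.
by move: Bt; rewrite e ltxx.
Qed.

(** Although the dual of [L^1] need not consist of functions, along a sequence
    [f] a functional acts through functionals [l] on [X] that depend on the
    point: almost everywhere the densities satisfy the hypothesis of
    [functional_interpolation]. *)
Lemma functional_disintegration (f : nat -> L1) : exists psi : nat -> T -> R,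
  [/\ forall k, mu.-integrable setT (EFin \o psi k),
   forall k B, measurable B ->
     ((phi (restr B (f k)))%:E = \int[mu]_(t in B) (psi k t)%:E)%E &
   {ae mu, forall t, exists2 l : X -> R, bounded_functional 1 l &
     forall k, l (f k t) = psi k t}].
Proof.
exists (fun k => dens (f k)); split=> // [k B mB|]; first exact: densE.
have : {ae mu, forall t, forall p : seq nat * seq nat,
    \sum_(k <- p.1) dens (f k) t - \sum_(k <- p.2) dens (f k) t <=
    `|\sum_(k <- p.1) f k t - \sum_(k <- p.2) f k t|}.
  apply: ae_forall_countable => -[s s'] /=.
  pose u : L1 := \sum_(k <- s) f k; pose v : L1 := \sum_(k <- s') f k.
  have [_ _ nE] := mnormP (L1_integrable (u - v)).1.
  apply: filterS3 (filterI (dens_le (u - v)) nE) (filterI (densB u v) (L1_subE u v))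
    (filterI (filterI (dens_sum s f) (dens_sum s' f))
      (filterI (L1_sumE s f) (L1_sumE s' f))).
  move=> t [h1 h2] [h3 h4] [[h5 h6] [h7 h8]].
  rewrite -h5 -h6 -h7 -h8.
  by rewrite -[X in X <= _]h3 -[X in `|X|]h4 h2.
by apply: filterS => t h; apply: functional_interpolation => s s'; exact: (h (s, s')).
Qed.

End functional.
End density.

(** * Pointwise weak limits *)

Section weak_limit.
Context (R : realType) (X : normedModType R) (x : nat -> X) (y : X).
Hypothesis xy : forall l : X -> R, bounded_functional 1 l -> l (x n) @[n --> \oo] --> l y.

Lemma weak_limit_average N (e : R) : 0 < e ->
  exists s, [/\ s != [::], all (leq N) s & `|average x s - y| < e].
Proof.
move=> e0; have e20 : 0 < e / 2 by rewrite divr_gt0.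
have [h hh hy] : exists2 h, tail_hull x N h & `|h - y| < e / 2.
  apply: contrapT => nh.
  have [c hc|l bl lN] := convex_separation (x := y) (@tail_hull_convex _ _ x N) (ltW e20).
    by rewrite leNgt; apply/negP => cy; apply: nh; exists c.
  have /cvgrPdist_lt/(_ _ e20)[n0 _ hn] := xy bl.
  have := hn (maxn n0 N) (leq_maxl _ _).
  have := lN _ (tail_hull_gen (f := x) (leq_maxr n0 N)).
  by rewrite ltr_norml => h /andP[]; lra.
have [s [s0 Ns hs]] := convex_hull_average e20 hh.
exists s; split=> //; rewrite -(subrK h (average x s)) -addrA.
by rewrite (le_lt_trans (ler_normD _ _))// distrC (splitr e) ltrD.
Qed.

Lemma weak_limit_average_ge z (e : R) : 0 < e -> exists N, forall s,
  s != [::] -> all (leq N) s -> `|y - z| <= `|average x s - z| + e.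
Proof.
move=> e0; have [l bl lyz] := exists_norming (y - z).
have [_ ll lN] := bl.
have /cvgrPdist_lt/(_ _ e0)[N _ hN] := xy bl.
exists N => s s0 Ns.
have : l y - e <= l (average x s).
  apply: (tail_hull_mem (C := [set h | l y - e <= l h]) (average_in_hull (x := x) s0 Ns)).
    move=> u v t /= hu hv t0 t1; rewrite (functionalD ll) !(functionalZ ll).
    have -> : l y - e = t * (l y - e) + (1 - t) * (l y - e) by ring.
    by rewrite lerD// ler_wpM2l// subr_ge0.
  by move=> k Nk /=; have := hN k Nk; rewrite ltr_norml => /andP[]; lra.
have := lN (average x s - z); rewrite mul1r ler_norml => /andP[_].
by rewrite -lyz !(functionalB ll); lra.
Qed.

(** The norm is weakly lower semicontinuous, and by Mazur's theorem equality
    is approached along averages. Averages being countably many, this makes the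
    distance to a pointwise weak limit measurable. *)
Lemma weak_limit_distance (S : nat -> nat -> seq nat) z :
  (forall N j, S N j != [::] /\ all (leq N) (S N j)) ->
  (forall N s, s != [::] -> all (leq N) s -> exists j, S N j = s) ->
  esups (fun N => einfs (fun j => `|average x (S N j) - z|%:E) 0) 0 = `|y - z|%:E.
Proof.
move=> SP Ssurj; apply/eqP; rewrite eq_le; apply/andP; split.
  apply: ge_ereal_sup => _ [N _ <-]; apply/lee_addgt0Pr => e e0.
  have [s [s0 Ns hs]] := weak_limit_average N e0.
  have [j Sj] := Ssurj N s s0 Ns.
  apply: ge_ereal_inf; exists (`|average x (S N j) - z|%:E); first by exists j.
  rewrite -EFinD lee_fin Sj -(subrK y (average x s)) -addrA addrC.
  by rewrite (le_trans (ler_normD _ _))// lerD2l ltW.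
apply/lee_addgt0Pr => e e0; have [N hN] := weak_limit_average_ge z e0.
rewrite -leeBlDr// -EFinB; apply: (@le_trans _ _
    (einfs (fun j => `|average x (S N j) - z|%:E) 0)); last first.
  by apply: ereal_sup_ubound; exists N.
apply: le_ereal_inf_tmp => _ [j _ <-].
have [s0 Ns] := SP N j.
by rewrite lee_fin lerBlDr hN.
Qed.

Lemma weak_limit_norm_le (e : R) : 0 < e -> \forall n \near \oo, `|y| <= `|x n| + e.
Proof.
move=> /(weak_limit_average_ge 0)[N hN]; exists N => // n /= Nn.
have := hN [:: n] isT; rewrite /= andbT Nn => /(_ isT).
by rewrite /average big_seq1 /= invr1 scale1r !subr0.
Qed.

End weak_limit.

(** For fixed [N] this enumerates, with repetitions, all the nonempty sequences of
    indices at least [N]; the default pair is taken for the [j] that encode no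
    pair. *)
Definition index_seq (N j : nat) : seq nat :=
  let p := odflt (0%N, [::]) (unpickle j : option (nat * seq nat)) in
  map (addn N) (p.1 :: p.2).

Lemma index_seqP N j : index_seq N j != [::] /\ all (leq N) (index_seq N j).
Proof.
split=> //; rewrite /index_seq; set p := odflt _ _.
by apply/allP => _ /mapP[k _ ->]; exact: leq_addr.
Qed.

Lemma index_seq_surj N s : s != [::] -> all (leq N) s -> exists j, index_seq N j = s.
Proof.
case: s => // k s _ /= /andP[Nk Ns].
exists (pickle ((k - N)%N, map (subn^~ N) s)); rewrite /index_seq pickleK /=.
rewrite subnKC// -map_comp; congr cons.
rewrite -[RHS]map_id; apply/eq_in_map => i si /=.
by rewrite subnKC//; move/allP: Ns; exact.
Qed.

Section pointwise_weak_limit.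
Context d (T : measurableType d) (R : realType) (X : normedModType R).
Variable mu : {measure set T -> \bar R}.
Local Notation L1 := (L1 X mu).
Variables (g : nat -> L1) (G : T -> X).
Hypothesis gG : {ae mu, forall t, forall l : X -> R, bounded_functional 1 l ->
  l (g n t) @[n --> \oo] --> l (G t)}.

Let a N j : L1 := average g (index_seq N j).

Let aE : {ae mu, forall t, forall p : nat * nat,
  a p.1 p.2 t = average (g ^~ t) (index_seq p.1 p.2)}.
Proof.
apply: ae_forall_countable => -[N j] /=.
rewrite /a /average; set s := index_seq N j; set u : L1 := \sum_(k <- s) g k.
by apply: filterS2 (L1_scaleE (size s)%:R^-1 u) (L1_sumE s g) => t -> ->.
Qed.

Let dist (h : L1) t : R :=
  fine (esups (fun N => einfs (fun j => (mnorm mu (a N j - h : L1) t)%:E) 0) 0).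

Let measurable_dist h : measurable_fun setT (dist h).
Proof.
apply: (measurableT_comp (fine_measurable measurableT)).
apply: measurable_fun_esups => N; apply: measurable_fun_einfs => j.
exact: measurable_mnormE.
Qed.

Let distE h : {ae mu, forall t, dist h t = `|G t - h t|}.
Proof.
have nE : {ae mu, forall t, forall p : nat * nat,
    mnorm mu (a p.1 p.2 - h : L1) t = `|a p.1 p.2 t - h t|}.
  apply: ae_forall_countable => -[N j] /=.
  have [_ _ mE] := mnormP (L1_integrable (a N j - h)).1.
  by apply: filterS2 mE (L1_subE (a N j) h) => t <- ->.
apply: filterS3 gG aE nE => t gt at' nt.
rewrite /dist (_ : (fun N => _) = (fun N => einfs
    (fun j => `|average (g ^~ t) (index_seq N j) - h t|%:E) 0)); last first.
  apply/funext => N; congr (einfs _ 0); apply/funext => j.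
  by rewrite (nt (N, j)) (at' (N, j)).
by rewrite (weak_limit_distance gt _ index_seqP index_seq_surj).
Qed.

Let closer (h b : L1) : L1 :=
  let B := [set t | dist b t < dist h t] in restr B b + restr (~` B) h.

Let closerP h b : {ae mu, forall t,
  `|G t - closer h b t| <= `|G t - b t| /\ `|G t - closer h b t| <= `|G t - h t|}.
Proof.
rewrite /closer; set B := [set t | _].
have mB : measurable B.
  by rewrite -[B]setTI; apply: measurable_fun_ltr => //; exact: measurable_dist.
have mBC : measurable (~` B) by exact: measurableC.
apply: filterS3 (filterI (distE h) (distE b)) (filterI (restrE b mB) (restrE h mBC))
  (L1_addE (restr B b) (restr (~` B) h)).
move=> t [dh db] [rb rh] ->; rewrite rb rh !indicE in_setC.
case: (boolP (t \in B)) => [/set_mem|/negP Bt].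
  rewrite /B /= dh db => Bt.
  by rewrite scale1r scale0r addr0; split=> //; exact: ltW.
rewrite scale0r scale1r add0r; split=> //; rewrite leNgt; apply/negP => lt.
by apply: Bt; apply/mem_set; rewrite /B /= dh db.
Qed.

(* The best approximant of [G t] among [a 0 0, ..., a 0 k]. *)
Let best : nat -> L1 := fix best k :=
  if k is k.+1 then closer (best k) (a 0 k.+1) else a 0 0.

(** Pettis' measurability theorem for a pointwise weak limit: it is the limit
    of its best approximants among the first averages. *)
Lemma strongly_measurable_weak_limit : strongly_measurable mu G.
Proof.
apply: (@strongly_measurable_limit _ _ _ _ _ best).
have step : {ae mu, forall t k, `|G t - best k.+1 t| <= `|G t - a 0 k.+1 t| /\
    `|G t - best k.+1 t| <= `|G t - best k t|}.
  by apply: ae_foralln => k; exact: closerP.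
apply: filterS3 step gG aE => t st gt at'.
have le j k : (j <= k)%N -> `|G t - best k t| <= `|G t - a 0 j t|.
  elim: k => [|k IH]; first by rewrite leqn0 => /eqP ->.
  rewrite leq_eqVlt => /predU1P[->|jk]; first exact: (st k).1.
  exact: le_trans (st k).2 (IH jk).
apply/cvgrPdist_lt => e e0.
have [s [s0 Ns hs]] := weak_limit_average gt 0 e0.
have [j Sj] := index_seq_surj s0 Ns.
exists j => // k /= jk; apply: (le_lt_trans (le _ _ jk)).
by rewrite (at' (0%N, j)) /= Sj distrC.
Qed.

Lemma bochner_integrable_weak_limit (C : R) : (forall n, `|g n| <= C) ->
  bochner_integrable mu G.
Proof.
move=> gC; split; first exact: strongly_measurable_weak_limit.
apply: le_lt_trans (ltry C).
apply: fatou_norm strongly_measurable_weak_limit _ gC.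
by apply: filterS gG => t gt e; exact: weak_limit_norm_le.
Qed.

End pointwise_weak_limit.

(** * From pointwise to weak convergence in [L^1] *)

Section weak_vitali.
Context d (T : measurableType d) (R : realType) (X : normedModType R).
Variable mu : {sigma_finite_measure set T -> \bar R}.
Local Notation L1 := (L1 X mu).

(** Vitali's theorem for the weak topology. By [functional_disintegration] the
    functional acts on the differences [g_n - G] through functionals on [X] at
    each point, so that the densities tend to zero almost everywhere; where a
    density exceeds [eps * w], which eventually happens on sets of small measure
    only, uniform integrability takes over. *)
Lemma weak_vitali w (g : nat -> L1) (G : L1) (phi : L1 -> R) : weight mu w ->
  weighted_ui w (range g) ->
  {ae mu, forall t, forall l : X -> R, bounded_functional 1 l ->
    l (g n t) @[n --> \oo] --> l (G t)} ->
  bounded_functional 1 phi -> phi (g n) @[n --> \oo] --> phi G.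
Proof.
move=> ww uig gG bphi; have [mw w0 _ iw] := ww.
have [_ lphi bdphi] := bphi.
have [psi [ipsi psiE lpsi]] := functional_disintegration bphi (fun n => g n - G).
have psi0 : {ae mu, forall t, psi n t @[n --> \oo] --> 0}.
  apply: filterS3 gG lpsi (ae_foralln (fun n => L1_subE (g n) G)) => t gt [l bl lp] st.
  have [_ ll _] := bl.
  rewrite (_ : (fun n => psi n t) = (fun n => l (g n t) - l (G t))); last first.
    by apply/funext => n; rewrite -lp st functionalB.
  by rewrite -(subrr (l (G t))); apply: cvgB; [exact: gt|exact: cvg_cst].
have mpsi n : measurable_fun setT (psi n).
  by apply/measurable_EFinP; exact: measurable_int (ipsi n).
have Wfin : (\int[mu]_t (w t)%:E)%E \is a fin_num by exact: integrable_fin_num.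
pose W := fine (\int[mu]_t (w t)%:E)%E.
have W0 : 0 <= W by apply: fine_ge0; apply: integral_ge0 => t _; rewrite lee_fin ltW.
apply/cvgrPdist_lt => e e0.
pose eps := e / 3 / (1 + W).
have W1 : 0 < 1 + W by rewrite ltr_pwDl.
have eps0 : 0 < eps by rewrite !divr_gt0.
pose E n := [set t | eps * w t < `|psi n t|].
have mE n : measurable (E n).
  rewrite -[E n]setTI; apply: (measurable_fun_ltr (f := fun t => eps * w t)) => //.
    by apply: measurable_funM => //; exact: measurable_cst.
  exact: measurableT_comp.
have Et : {ae mu, forall t, \forall n \near \oo, ~ E n t}.
  apply: filterS psi0 => t /cvgrPdist_lt pt.
  have ew : 0 < eps * w t by rewrite mulr_gt0.
  apply: filterS (pt _ ew) => n; rewrite sub0r normrN => h.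
  by apply/negP; rewrite -leNgt ltW.
have /fine_cvgP[fin cvg0] := integral_vanishing_sets iw (fun t => ltW (w0 t)) mE Et.
have e30 : 0 < e / 3 by rewrite divr_gt0.
have [d1 d10 h1] := uig _ e30.
have [d2 d20 h2] := mass_weight G ww e30.
have dm : 0 < Num.min d1 d2 by rewrite lt_min d10.
apply: filterS2 fin (cvgr_lt _ cvg0 _ dm) => n fn; rewrite lt_min => /andP[E1 E2].
have mEC : measurable (~` E n) by exact: measurableC.
rewrite distrC -functionalB//.
have -> : g n - G = restr (E n) (g n - G) + restr (~` E n) (g n - G).
  by rewrite -restrU ?setUv ?restrT// setICr.
rewrite functionalD// (le_lt_trans (ler_normD _ _))//.
have b1 : `|phi (restr (E n) (g n - G))| < e / 3 + e / 3.
  apply: (le_lt_trans (bdphi _)); rewrite mul1r norm_restr.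
  apply: (le_lt_trans (massD _ _ (mE n))); rewrite massN//.
  apply: ltrD.
    by apply: h1 => //; rewrite -(fineK fn) lte_fin.
  by apply: h2 => //; rewrite -(fineK fn) lte_fin.
have b2 : `|phi (restr (~` E n) (g n - G))| <= e / 3.
  rewrite -lee_fin -abse_EFin psiE//.
  apply: (@le_trans _ _ (\int[mu]_(t in ~` E n) `|(psi n t)%:E|)%E).
    apply: le_abse_integral => //; apply: measurable_funTS.
    exact/measurable_EFinP.
  apply: (@le_trans _ _ (\int[mu]_(t in ~` E n) (eps%:E * (w t)%:E))%E).
    apply: ge0_le_integral => //.
    - by apply: measurableT_comp => //; apply: measurable_funTS; exact/measurable_EFinP.
    - apply: emeasurable_funM; first exact: measurable_cst.
      by apply: measurable_funTS; exact/measurable_EFinP.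
    by move=> t /negP; rewrite -leNgt /= lee_fin.
  rewrite ge0_integralZl//; last 3 first.
  - by apply: measurable_funTS; exact/measurable_EFinP.
  - by move=> t _; rewrite lee_fin ltW.
  - by rewrite lee_fin ltW.
  apply: (@le_trans _ _ (eps%:E * W%:E)%E).
    apply: lee_wpmul2l; first by rewrite lee_fin ltW.
    rewrite fineK//; apply: ge0_subset_integral => //.
      exact/measurable_EFinP.
    by move=> t _; rewrite lee_fin ltW.
  rewrite -EFinM lee_fin /eps mulrAC ler_pdivrMr// ler_pM2l// lerDr//.
by apply: lt_le_trans (ltr_leD b1 b2) _; lra.
Qed.

End weak_vitali.

Section equi_integrable_tail_hulls.
Context d (T : measurableType d) (R : realType) (X : normedModType R).
Variable mu : {sigma_finite_measure set T -> \bar R}.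
Local Notation L1 := (L1 X mu).

Lemma weighted_ui_tail_hull w (H : set L1) (f : nat -> L1) n :
  weighted_ui w H -> (forall k, H (f k)) -> weighted_ui w (tail_hull f n).
Proof.
move=> uiH Hf e e0; have [delta d0 dP] := uiH _ e0.
exists delta => // u hu B mB Bd.
apply: (tail_hull_mem (C := [set u | mass B u < e]) hu) => [x y t /= xe ye t0 t1|k _].
  apply: (le_lt_trans (massD _ _ mB)).
  rewrite !massZ// !ger0_norm ?subr_ge0//.
  have [->|tn0] := eqVneq t 0; first by rewrite mul0r add0r subr0 mul1r.
  have tp : 0 < t by rewrite lt_neqAle eq_sym tn0.
  have -> : e = t * e + (1 - t) * e by ring.
  apply: ltr_leD; first by rewrite ltr_pM2l.
  by rewrite ler_wpM2l ?subr_ge0// ltW.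
exact: dP.
Qed.

Lemma norm_tail_hull_le (E : normedModType R) (f : nat -> E) n (M : R) u :
  (forall k, `|f k| <= M) -> tail_hull f n u -> `|u| <= M.
Proof.
move=> fM hu; apply: (tail_hull_mem (C := [set u | `|u| <= M]) hu) => [x y t /= hx hy t0 t1|k _]; last exact: fM.
apply: (le_trans (ler_normD _ _)); rewrite !normrZ !ger0_norm ?subr_ge0//.
have -> : M = t * M + (1 - t) * M by ring.
by rewrite lerD// ler_wpM2l// subr_ge0.
Qed.

(** The common limit is the pointwise weak limit of the combinations [g_n]: by
    [weak_vitali] no functional separates it from a tail. *)
Lemma weak_limits_tail_hulls_meet (H : set L1) : bounded_set H ->
  equi_integrable H ->
  (forall f : nat -> L1, (forall n, H (f n)) ->
     exists2 g : nat -> L1, forall n, tail_hull f n (g n) &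
       {ae mu, forall t, exists x : weak X, (fun n => g n t : weak X) @ \oo --> x}) ->
  tail_hulls_meet H.
Proof.
move=> bH eqH conv f Hf.
have [w ww] := exists_weight mu.
have uiH := equi_integrable_weighted_ui ww eqH.
have [M M0 HM] := pinfty_ex_gt0 bH.
have [g gf gcvg] := conv f Hf.
pose G t : X := xget 0 [set x : X | (fun n => g n t : weak X) @ \oo --> (x : weak X)].
have gG : {ae mu, forall t, forall l : X -> R, bounded_functional 1 l ->
    l (g n t) @[n --> \oo] --> l (G t)}.
  apply: filterS gcvg => t [x gx] l bl.
  have : (fun n => g n t : weak X) @ \oo --> (G t : weak X).
    by rewrite /G; case: xgetP => [y _ //|/(_ x)].
  have [phi phiE] := bounded_dual bl.
  move=> /weak_cvgP/(_ phi); rewrite phiE.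
  by rewrite (_ : (sval phi : X -> R) = l)//; apply/funext.
have gM n : `|g n| <= M.
  by apply: norm_tail_hull_le (gf n) => k; exact: HM.
have iG := bochner_integrable_weak_limit gG gM.
have GE := mkL1E iG.
exists (mkL1 mu G) => n e e0; apply: contrapT => nh.
have [c hc|phi bphi phiP] := convex_separation (x := mkL1 mu G)
    (@tail_hull_convex _ _ f n) (ltW e0).
  by rewrite leNgt; apply/negP => cy; apply: nh; exists c.
have tail_mono k : (n <= k)%N -> tail_hull f k `<=` tail_hull f n.
  move=> nk u hu; apply: (tail_hull_mem hu) => [x y t hx hy t0 t1|j kj].
    by have /convex_setP := @tail_hull_convex R _ f n; apply.
  by apply: tail_hull_gen; exact: leq_trans nk kj.
have uig : weighted_ui w (range g).
  move=> r r0; have [delta d0 dP] := weighted_ui_tail_hull 0 uiH Hf r0.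
  exists delta => // _ [k _ <-]; apply: dP.
  apply: (tail_hull_mem (gf k)) => [x y t hx hy t0 t1|j kj].
    by have /convex_setP := @tail_hull_convex R _ f 0; apply.
  exact: tail_hull_gen.
have gG' : {ae mu, forall t, forall l : X -> R, bounded_functional 1 l ->
    l (g n t) @[n --> \oo] --> l (mkL1 mu G t)}.
  by apply: filterS2 gG GE => t h ->.
have /cvgrPdist_lt/(_ _ e0)[N _ hN] := weak_vitali ww uig gG' bphi.
have := hN (maxn N n) (leq_maxl _ _).
have := phiP _ (tail_mono _ (leq_maxr N n) _ (gf (maxn N n))).
by rewrite ltr_norml => h /andP[]; lra.
Qed.

End equi_integrable_tail_hulls.

(** * Relative weak compactness in [L^1] *)

Unset Implicit Arguments.

Theorem theorem2p7 (d : measure_display) (T : measurableType d) (R : realType)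
    (X : completeNormedModType R)
    (mu : {sigma_finite_measure set T -> \bar R})
    (H : set (L1 X mu)) (hH : bounded_set H) :
  [<-> precompact (H : set (weak (L1 X mu)));
       equi_integrable H /\
       forall f : nat -> L1 X mu, (forall n, H (f n)) ->
         exists2 g : nat -> L1 X mu,
           forall n, convex_hull [set f k | k in [set k | (n <= k)%N]] (g n) &
           {ae mu, forall t, exists x : X, (fun n => g n t) @ \oo --> x};
       equi_integrable H /\
       forall f : nat -> L1 X mu, (forall n, H (f n)) ->
         exists2 g : nat -> L1 X mu,
           forall n, convex_hull [set f k | k in [set k | (n <= k)%N]] (g n) &
           {ae mu, forall t, exists x : weak X,
             (fun n => g n t : weak X) @ \oo --> x}].
Proof.
have [M M0 HM] := pinfty_ex_gt0 hH.
tfae.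
- move=> /precompact_tail_hulls_meet meetH; split.
    have [w ww] := exists_weight mu.
    have uiH := tail_hulls_meet_weighted_ui ww HM meetH.
    exact: weighted_ui_equi_integrable ww HM uiH.
  move=> f Hf; have [u uP] := meetH f Hf.
  have /choice[g gP] : forall n, exists g, tail_hull f n g /\ `|g - u| <= 2 ^- n.
    move=> n; have [|h hh hu] := uP n (2 ^- n); first by rewrite invr_gt0 exprn_gt0.
    by exists h; split=> //; exact: ltW.
  exists g => [n|]; first exact: (gP n).1.
  have := ae_cvg_of_norm (fun n => (gP n).2).
  by apply: filterS => t gt; exists ((u : L1 X mu) t).
- move=> [eqH conv]; split=> // f Hf; have [g gf gcvg] := conv f Hf.
  exists g => //; apply: filterS gcvg => t [x gx]; exists x.
  apply/weak_cvgP => phi; apply: continuous_cvg gx.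
  exact: (svalP phi).
- move=> [eqH conv]; apply: tail_hulls_meet_precompact => //.
    exact: L1_complete.
  exact: weak_limits_tail_hulls_meet.
Qed.
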